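(* Consider birth rates $b_i>0$ ($i\ge0$) and death rates $a_i>0$ ($i\ge1$) on $\mathbb Z_+=\{0,1,2,\dots\}$, and let $\mathscr D^{\max}(D)=\{f\in L^2(\mu):D(f)<\infty\}$. Then the Dirichlet form $(D,\mathscr D^{\max}(D))$ is regular if and only if $$\sum_{k=0}^\infty\Big(\frac1{b_k\mu_k}+\mu_k\Big)=\infty .$$ In other words, the Dirichlet form corresponding to the rates $(a_i)$ and $(b_i)$ is unique if and only if this condition holds.
   Context: $\mu_0=1$, $\mu_n=\frac{b_0\cdots b_{n-1}}{a_1\cdots a_n}$ for $n\ge1$; $D(f)=\sum_{i\ge0}\mu_ib_i(f_{i+1}-f_i)^2$. Let $\mathscr K$ be the set of functions on $\mathbb Z_+$ with finite support and $\|f\|_D^2=\|f\|_{L^2(\mu)}^2+D(f)$. A Dirichlet form $(D,\mathscr D(D))$ on $L^2(\mu)$ is regular here if $\mathscr K$ is dense in $\mathscr D(D)$ with respect to $\|\cdot\|_D$; the closure of $\mathscr K$ for $\|\cdot\|_D$ is the minimal domain. A Dirichlet form on $L^2(\mu)$ ''corresponds to the rates'' if the transition function $p_{ij}(t)$ of its semigroup satisfies $p_{ij}'(0)=q_{ij}$, where $Q=(q_{ij})$ is the birth--death matrix $q_{i,i+1}=b_i$, $q_{i,i-1}=a_i$ ($i\ge1$), $q_{ii}=-(a_i+b_i)$ (with $a_0=0$), and $q_{ij}=0$ otherwise. *)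

(* Defs.v *)
From HB Require Import structures.
From mathcomp Require Import all_boot all_order all_algebra.
From mathcomp Require Import all_classical all_reals all_analysis.
Set Implicit Arguments.
Unset Strict Implicit.
Unset Printing Implicit Defensive.
Import Order.TTheory GRing.Theory Num.Theory.
Import numFieldNormedType.Exports.
Local Open Scope classical_set_scope.
Local Open Scope ring_scope.

(* Every weight [mu] used below is strictly positive, so L^2(mu) needs no
   quotient by null functions and convergence in it is convergence in
   [L2norm]. *)

Definition L2 (R : realType) (mu : nat -> R) : set (nat -> R) :=
  [set f | (\sum_(0 <= i <oo) (mu i * f i ^+ 2)%:E < +oo)%E].

(* Meaningful for [f] and [g] in [L2 mu], where the series converges
   absolutely. *)
Definition L2dot (R : realType) (mu : nat -> R) (f g : nat -> R) : R :=
  limn (series (fun i => mu i * f i * g i)).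

Definition L2norm (R : realType) (mu : nat -> R) (f : nat -> R) : R :=
  Num.sqrt (L2dot mu f f).

Definition fin_support (R : realType) : set (nat -> R) :=
  [set f | finite_set [set i | f i != 0]].

Definition unit_fun (R : realType) (j : nat) : nat -> R :=
  fun i => (i == j)%:R.

(* A bilinear form with its domain; the values of [form_val] off
   [form_dom] are irrelevant, whence [form_eq]. *)
Record L2form (R : realType) := Form {
  form_dom : set (nat -> R);
  form_val :> (nat -> R) -> (nat -> R) -> R }.

Definition form_eq (R : realType) (E F : L2form R) : Prop :=
  form_dom E = form_dom F /\
  forall f g, form_dom E f -> form_dom E g -> E f g = F f g.

(* ||f||_E = (||f||^2 + E(f, f))^(1/2) *)
Definition form_norm (R : realType) (mu : nat -> R) (E : L2form R)
    (f : nat -> R) : R :=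
  Num.sqrt (L2norm mu f ^+ 2 + E f f).

Record dirichlet_form (R : realType) (mu : nat -> R) (E : L2form R) : Prop := {
  df_L2 : form_dom E `<=` L2 mu;
  df_zero : form_dom E 0;
  df_lin : forall (c : R) f g,
    form_dom E f -> form_dom E g -> form_dom E (c *: f + g);
  df_dense : forall f, L2 mu f -> forall e : R, 0 < e ->
    exists2 g, form_dom E g & L2norm mu (f - g) < e;
  df_sym : forall f g, form_dom E f -> form_dom E g -> E f g = E g f;
  df_bilin : forall (c : R) f g h,
    form_dom E f -> form_dom E g -> form_dom E h ->
    E (c *: f + g) h = c * E f h + E g h;
  df_ge0 : forall f, form_dom E f -> 0 <= E f f;
  df_closed : forall u : nat -> (nat -> R),
    (forall n, form_dom E (u n)) ->
    (forall e : R, 0 < e -> exists N, forall m n, (N <= m)%N -> (N <= n)%N ->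
       form_norm mu E (u m - u n) < e) ->
    exists2 f, form_dom E f &
      (fun n => form_norm mu E (u n - f)) @ \oo --> (0 : R);
  df_markov : forall f, form_dom E f ->
    let f1 := fun i => Num.min (Num.max (f i) 0) 1 in
    form_dom E f1 /\ E f1 f1 <= E f f }.

Definition regular_form (R : realType) (mu : nat -> R) (E : L2form R) : Prop :=
  @fin_support R `<=` form_dom E /\
  forall f, form_dom E f -> forall e : R, 0 < e ->
    exists2 g, @fin_support R g & form_norm mu E (f - g) < e.

Record L2_semigroup (R : realType) (mu : nat -> R)
    (T : R -> (nat -> R) -> (nat -> R)) : Prop := {
  sg_L2 : forall t f, 0 <= t -> L2 mu f -> L2 mu (T t f);
  sg_lin : forall t (c : R) f g, 0 <= t -> L2 mu f -> L2 mu g ->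
    T t (c *: f + g) = c *: T t f + T t g;
  sg_0 : forall f, L2 mu f -> T 0 f = f;
  sg_add : forall s t f, 0 <= s -> 0 <= t -> L2 mu f ->
    T (s + t) f = T s (T t f);
  sg_sym : forall t f g, 0 <= t -> L2 mu f -> L2 mu g ->
    L2dot mu (T t f) g = L2dot mu f (T t g);
  sg_contr : forall t f, 0 <= t -> L2 mu f -> L2norm mu (T t f) <= L2norm mu f;
  sg_cont : forall f, L2 mu f ->
    (fun t => L2norm mu (T t f - f)) @ 0^'+ --> (0 : R) }.

(* [f] is in the domain of the infinitesimal generator of [T], with image
   [g]. *)
Definition sg_generator (R : realType) (mu : nat -> R)
    (T : R -> (nat -> R) -> (nat -> R)) (f g : nat -> R) : Prop :=
  [/\ L2 mu f, L2 mu g &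
    (fun t => L2norm mu (t^-1 *: (T t f - f) - g)) @ 0^'+ --> (0 : R)].

(* Graph of the self-adjoint operator A associated with [E], in the sign
   convention E(f, h) = (- A f, h). *)
Definition form_operator (R : realType) (mu : nat -> R) (E : L2form R)
    (f g : nat -> R) : Prop :=
  [/\ form_dom E f, L2 mu g &
    forall h, form_dom E h -> E f h = - L2dot mu g h].

(* [T] is the semigroup exp(tA) of the form [E]. *)
Definition semigroup_of (R : realType) (mu : nat -> R) (E : L2form R)
    (T : R -> (nat -> R) -> (nat -> R)) : Prop :=
  L2_semigroup mu T /\
  forall f g, sg_generator mu T f g <-> form_operator mu E f g.

(* p_ij(t) is the kernel of T_t with respect to the counting measure:
   (T_t f)(i) = sum_j p_ij(t) f(j). *)
Definition transition_fun (R : realType) (T : R -> (nat -> R) -> (nat -> R))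
    (t : R) (i j : nat) : R :=
  T t (@unit_fun R j) i.

Definition bd_mu (R : realType) (a b : nat -> R) (n : nat) : R :=
  (\prod_(0 <= i < n) b i) / (\prod_(1 <= i < n.+1) a i).

(* For [i = 0] the diagonal entry is [- (a 0 + b 0)]; the convention is
   [a 0 = 0]. *)
Definition bd_Q (R : realType) (a b : nat -> R) (i j : nat) : R :=
  if j == i.+1 then b i
  else if j.+1 == i then a i
  else if j == i then - (a i + b i)
  else 0.

Definition bd_D (R : realType) (a b : nat -> R) (f : nat -> R) : \bar R :=
  (\sum_(0 <= i <oo) (bd_mu a b i * b i * (f i.+1 - f i) ^+ 2)%:E)%E.

(* The polarization of [bd_D], on the maximal domain. *)
Definition bd_max_form (R : realType) (a b : nat -> R) : L2form R :=
  Form [set f | L2 (bd_mu a b) f /\ (bd_D a b f < +oo)%E]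
    (fun f g => limn (series (fun i =>
       bd_mu a b i * b i * (f i.+1 - f i) * (g i.+1 - g i)))).

Definition corresponds_to_rates (R : realType) (a b : nat -> R)
    (E : L2form R) : Prop :=
  dirichlet_form (bd_mu a b) E /\
  exists2 T, semigroup_of (bd_mu a b) E T &
    forall i j,
      (fun t : R => t^-1 * (transition_fun T t i j - transition_fun T 0 i j))
        @ 0^'+ --> bd_Q a b i j.

(* Main.v *)
Require Import Defs.
From HB Require Import structures.
From mathcomp Require Import all_boot all_order all_algebra.
From mathcomp Require Import all_classical all_reals all_analysis.
From mathcomp Require Import ring lra.
Set Implicit Arguments.
Unset Strict Implicit.
Unset Printing Implicit Defensive.
Import Order.TTheory GRing.Theory Num.Theory.
Import numFieldNormedType.Exports.
Local Open Scope classical_set_scope.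
Local Open Scope ring_scope.

(* Write [w_i = mu_i b_i], so that [D f = sum w_i (f_(i+1) - f_i)^2].

   Regularity: a function [v] of the maximal domain which is orthogonal to the
   finitely supported functions solves [A v = v]; then [v] and its flux
   [w_i (v_(i+1) - v_i)] stay at least [|v_0|] in absolute value, so
   [|v|^2 + D v >= v_0^2 sum (1 / w_i + mu_i)], and [v = 0] when the series
   diverges.  When it converges, [sup |f|^2 <= C (|f|^2 + D f)], hence the
   functions vanishing at infinity form a closed proper subspace (it misses the
   constant 1) on which [D] is again a Dirichlet form with the same rates.

   Uniqueness in the divergent case: if [E] corresponds to the rates through
   [T], the limits of [<f - T_t f, f> / t] for finitely supported [f] show that
   [E] extends [D] on these functions; the resolvents of [E] are Markovian, so
   [<f - J_h f, f> / h <= E f f] gives [D <= E] on the domain of [E] (Beurling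
   and Deny), and density forces [E] to be the maximal form.

   Existence: the semigroup of a closed form is the Post-Widder limit
   [T_t = lim (1 - (t / n) A)^(-n)], which converges on the domain of [A^2]. *)

(** * Semi-inner products and the Riesz lemma *)

(** The obstacle to uniqueness is how little correspondence to the rates says: the entries [p_ij(t)]
    are differentiable at 0, which does not even place the unit functions in the domain of [E] a
    priori. The form has to be recovered from its semigroup: if [<f - T_t f, f> / t] has a finite
    limit as [t] decreases to 0, then [f] is in the form domain and the limit is [E f f]. The usual
    route is the spectral theorem. Here Riesz representation on the generator domain gives
    membership; Cauchy-Schwarz and the concavity of [<g - T_s g, g>] in [s] give the value.

    The Markov property is assumed of the form. It passes easily to resolvents, which solve a
    minimization problem; so the Beurling-Deny step uses [J_h], while the rates enter through [T_t].

    The same algebra is applied to [dot], to [E], to their combinations and to [<f - T_t f, g>],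
    each on its own domain and possibly degenerate. Hence [semi_inner] is relative to a set [D] and
    asks for no definiteness. *)

Record semi_inner (R : realType) (V : lmodType R) (D : set V)
    (B : V -> V -> R) : Prop := SemiInner {
  si_zero : D 0;
  si_lin : forall c f g, D f -> D g -> D (c *: f + g);
  si_sym : forall f g, D f -> D g -> B f g = B g f;
  si_bilin : forall c f g h, D f -> D g -> D h ->
    B (c *: f + g) h = c * B f h + B g h;
  si_ge0 : forall f, D f -> 0 <= B f f }.

(** A quadratic in [s] without sign change has nonpositive discriminant. Besides Cauchy-Schwarz,
    this serves for approximate minimizers, where [e] is the defect of minimality. *)
Lemma discriminant_le (R : realType) (e x G : R) : 0 <= G ->
  (forall s, 0 <= e + 2 * s * x + s ^+ 2 * G) -> x ^+ 2 <= e * G.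
Proof.
move=> G0 H.
have [G1|G1] := eqVneq G 0.
  suff -> : x = 0 by rewrite expr0n G1 mulr0.
  apply/eqP; apply: contraT => x0.
  (* For [G = 0] the expression is affine in [s], and this [s] gives it the value -1. *)
  have := H (- (e + 1) / (2 * x)).
  have -> : 2 * (- (e + 1) / (2 * x)) * x = - (e + 1) by field.
  by rewrite G1 mulr0 addr0; lra.
have {}G0 : 0 < G by rewrite lt0r G1.
have := H (- x / G).
have -> : e + 2 * (- x / G) * x + (- x / G) ^+ 2 * G = (e * G - x ^+ 2) / G.
  by field; lra.
by rewrite pmulr_lge0 ?invr_gt0// subr_ge0.
Qed.

Lemma normr_le_sqr (R : realType) (x e : R) : 0 <= e -> x ^+ 2 <= e ^+ 2 ->
  `|x| <= e.
Proof. by move=> e0; rewrite -real_normK ?num_real// ler_sqr ?nnegrE. Qed.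

Lemma normr_lt_sqr (R : realType) (x e : R) : 0 <= e -> x ^+ 2 < e ^+ 2 ->
  `|x| < e.
Proof. by move=> e0; rewrite -real_normK ?num_real// ltr_sqr ?nnegrE. Qed.

Lemma ler_norm_sqr (R : realDomainType) (x y : R) : `|x| <= `|y| ->
  x ^+ 2 <= y ^+ 2.
Proof.
by rewrite -[x ^+ 2]real_normK ?num_real// -[y ^+ 2]real_normK ?num_real// ler_sqr ?nnegrE.
Qed.

Section semi_inner_theory.
Context (R : realType) (V : lmodType R) (D : set V) (B : V -> V -> R).
Hypothesis hB : semi_inner D B.

Lemma si_D f g : D f -> D g -> D (f + g).
Proof. by move=> Df Dg; rewrite -[f]scale1r; exact: (si_lin hB). Qed.

Lemma si_Z c f : D f -> D (c *: f).
Proof. by move=> Df; rewrite -[_ *: _]addr0; apply: (si_lin hB) => //; exact: (si_zero hB). Qed.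

Lemma si_B f g : D f -> D g -> D (f - g).
Proof. by move=> Df Dg; apply: si_D => //; rewrite -scaleN1r; exact: si_Z. Qed.

Lemma siDl f g h : D f -> D g -> D h -> B (f + g) h = B f h + B g h.
Proof. by move=> *; rewrite -[f]scale1r (si_bilin hB)// mul1r scale1r. Qed.

Lemma si0l h : D h -> B 0 h = 0.
Proof.
move=> Dh; have D0 := si_zero hB.
have := siDl D0 D0 Dh; rewrite addr0 => /eqP.
by rewrite -subr_eq0 opprD addNKr oppr_eq0 => /eqP.
Qed.

Lemma siZl c f h : D f -> D h -> B (c *: f) h = c * B f h.
Proof.
move=> Df Dh; have D0 := si_zero hB.
by have := si_bilin hB c Df D0 Dh; rewrite addr0 si0l// addr0.
Qed.

Lemma siBl f g h : D f -> D g -> D h -> B (f - g) h = B f h - B g h.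
Proof.
move=> Df Dg Dh; rewrite siDl//; last by rewrite -scaleN1r; exact: si_Z.
by rewrite -scaleN1r siZl// mulN1r.
Qed.

Lemma siDr f g h : D f -> D g -> D h -> B h (f + g) = B h f + B h g.
Proof.
by move=> *; rewrite (si_sym hB) ?siDl//; [congr (_ + _); exact: (si_sym hB)|exact: si_D].
Qed.

Lemma siZr c f h : D f -> D h -> B h (c *: f) = c * B h f.
Proof.
by move=> *; rewrite (si_sym hB) ?siZl//; [congr (_ * _); exact: (si_sym hB)|exact: si_Z].
Qed.

Lemma siBr f g h : D f -> D g -> D h -> B h (f - g) = B h f - B h g.
Proof.
by move=> *; rewrite (si_sym hB) ?siBl//; [congr (_ - _); exact: (si_sym hB)|exact: si_B].
Qed.

Lemma si_sqB f g : D f -> D g ->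
  B (f - g) (f - g) = B f f - 2 * B f g + B g g.
Proof.
move=> Df Dg; have Dfg := si_B Df Dg.
by rewrite siBl// !siBr// (si_sym hB Dg Df); ring.
Qed.

Lemma si_sqC f g : D f -> D g -> B (f - g) (f - g) = B (g - f) (g - f).
Proof. by move=> Df Dg; rewrite !si_sqB// (si_sym hB Dg Df); ring. Qed.

Lemma si_sqDZ f g s : D f -> D g ->
  B (f + s *: g) (f + s *: g) = B f f + 2 * s * B f g + s ^+ 2 * B g g.
Proof.
move=> Df Dg; have Dsg := si_Z s Dg; have Dfg := si_D Df Dsg.
by rewrite siDl// !siDr// !siZl// !siZr// (si_sym hB Dg Df); ring.
Qed.

Lemma si_sqZ c f : D f -> B (c *: f) (c *: f) = c ^+ 2 * B f f.
Proof. by move=> Df; have Dcf := si_Z c Df; rewrite siZl// siZr// mulrA expr2. Qed.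

Lemma si_CS f g : D f -> D g -> B f g ^+ 2 <= B f f * B g g.
Proof.
move=> Df Dg; apply: discriminant_le => [|s]; rewrite -?si_sqDZ//; first exact: (si_ge0 hB).
by apply: (si_ge0 hB); apply: si_D => //; exact: si_Z.
Qed.

Lemma si_sqD_le f g : D f -> D g ->
  B (f + g) (f + g) <= 2 * B f f + 2 * B g g.
Proof.
move=> Df Dg.
have := si_ge0 hB (si_B Df Dg); rewrite si_sqB//.
by have := si_sqDZ 1 Df Dg; rewrite scale1r => ->; lra.
Qed.

Lemma si_sqB_le f g h : D f -> D g -> D h ->
  B (f - h) (f - h) <= 2 * B (f - g) (f - g) + 2 * B (g - h) (g - h).
Proof.
move=> Df Dg Dh; rewrite -[f - h](subrKA g).
by apply: si_sqD_le; exact: si_B.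
Qed.

Lemma si_CS_abs f g : D f -> D g ->
  `|B f g| <= Num.sqrt (B f f) * Num.sqrt (B g g).
Proof.
move=> Df Dg; rewrite -sqrtr_sqr -sqrtrM; last exact: (si_ge0 hB).
exact: ler_wsqrtr (si_CS Df Dg).
Qed.

Lemma si_cvg_l (u : nat -> V) f g : (forall n, D (u n)) -> D f -> D g ->
  (fun n => B (u n - f) (u n - f)) @ \oo --> 0 ->
  (fun n => B (u n) g) @ \oo --> B f g.
Proof.
move=> Du Df Dg uf; apply/cvgrPdist_le => e e0.
(* The [+ 1] keeps the divisor positive, since [B g g] may be 0. *)
pose G := B g g + 1.
have G0 : 0 < G by rewrite /G ltr_wpDl// (si_ge0 hB).
have d0 : 0 < e ^+ 2 / G by rewrite divr_gt0// exprn_gt0.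
move/cvgrPdist_lt: uf => /(_ _ d0); apply: filterS => n.
have Duf := si_B (Du n) Df.
rewrite sub0r normrN ger0_norm ?(si_ge0 hB)// => H.
rewrite distrC -siBl//.
apply: normr_le_sqr; first exact: ltW.
apply: le_trans (si_CS Duf Dg) _.
have -> : e ^+ 2 = e ^+ 2 / G * G by rewrite divfK ?gt_eqF.
apply: ler_pM; rewrite ?(si_ge0 hB)// ?ltW// /G ltrDl; exact: ltr01.
Qed.

Lemma si_cvg_sq (u : nat -> V) f : (forall n, D (u n)) -> D f ->
  (fun n => B (u n - f) (u n - f)) @ \oo --> 0 ->
  (fun n => B (u n) (u n)) @ \oo --> B f f.
Proof.
move=> Du Df uf.
have h : (fun n => B (u n) f * 2) @ \oo --> B f f * 2.
  by apply: cvgMr_tmp; exact: si_cvg_l.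
have -> : B f f = 0 + B f f * 2 - B f f by ring.
have -> : (fun n => B (u n) (u n)) =
    (fun n => B (u n - f) (u n - f) + B (u n) f * 2 - B f f).
  by apply/funext => n; rewrite si_sqB//; ring.
by apply: cvgB; [exact: cvgD|exact: cvg_cst].
Qed.

End semi_inner_theory.

(** [B] plays the part of a squared norm, so that no topology on [V] is involved: the notion applies
    to bare sequences and to the normed space [l2] alike. *)
Definition si_complete (R : realType) (V : lmodType R) (D : set V)
    (B : V -> V -> R) : Prop :=
  forall u : nat -> V, (forall n, D (u n)) ->
    (forall e : R, 0 < e -> exists N, forall m n, (N <= m)%N -> (N <= n)%N ->
       B (u m - u n) (u m - u n) < e) ->
    exists2 f, D f & (fun n => B (u n - f) (u n - f)) @ \oo --> (0 : R).

Lemma harmonic_small (R : realType) (e : R) : 0 < e ->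
  exists N, forall n, (N <= n)%N -> n.+1%:R^-1 < e.
Proof.
move=> e0; have := @cvg_harmonic R => /cvgrPdist_lt/(_ e e0)[N _ H].
exists N => n /H /=; rewrite sub0r normrN ger0_norm//.
Qed.

(* The functional need only be bounded on a subspace [S]; the representative is
   found by minimizing [B g g - 2 * l g] over [S]. *)
Lemma riesz (R : realType) (V : lmodType R) (D S : set V) (B : V -> V -> R)
    (l : V -> R) (M : R) :
  semi_inner D B -> si_complete D B -> 0 <= M -> S `<=` D -> S 0 ->
  (forall c f g, S f -> S g -> S (c *: f + g)) ->
  (forall c f g, S f -> S g -> l (c *: f + g) = c * l f + l g) ->
  (forall g, S g -> l g ^+ 2 <= M * B g g) ->
  exists u, [/\ D u, forall g, S g -> B u g = l g &
    forall e, 0 < e -> exists2 g, S g & B (u - g) (u - g) < e].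
Proof.
move=> hB Bc M0 SD S0 Slin llin lM.
have HS : semi_inner S B.
  by split=> //; [move=> *; apply: (si_sym hB); exact: SD
    |move=> *; apply: (si_bilin hB); exact: SD|move=> *; apply: (si_ge0 hB); exact: SD].
have lZ c g : S g -> l (c *: g) = c * l g.
  move=> Sg; have h0 : l 0 = 0.
    have := llin 1 0 0 S0 S0; rewrite scaler0 addr0 mul1r => /eqP.
    by rewrite -subr_eq0 opprD addNKr oppr_eq0 => /eqP.
  by have := llin c g 0 Sg S0; rewrite addr0 h0 addr0.
have lD f g : S f -> S g -> l (f + g) = l f + l g.
  by move=> Sf Sg; have := llin 1 f g Sf Sg; rewrite scale1r mul1r.
pose J g := B g g - 2 * l g.
pose A := [set J g | g in S].
have A_lb : has_lbound A.
  exists (- (M + 1) ) => _ [g Sg <-]; rewrite /J.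
  have Bg := si_ge0 HS Sg.
  have M1 : l g ^+ 2 <= M * B g g := lM _ Sg.
  (* By [4 M B g g <= (B g g + M)^2]; hence [J] is bounded below. *)
  have : `|2 * l g| <= B g g + M.
    by apply: normr_le_sqr; [lra|have := sqr_ge0 (B g g - M); nra].
  by rewrite ler_norml => /andP[_]; lra.
have A0 : A !=set0 by exists (J 0); exists 0.
pose m := inf A.
have mJ g : S g -> m <= J g.
  by move=> Sg; apply: (ge_inf A_lb); exists g.
have mS n : exists g, S g /\ J g < m + n.+1%:R^-1.
  have n0 : 0 < n.+1%:R^-1 :> R by rewrite invr_gt0.
  have [_ [g Sg <-] H] := inf_adherent n0 (conj A0 A_lb).
  by exists g.
have [u uS] := choice mS.
have Su n : S (u n) by have [] := uS n.
have uJ n : J (u n) < m + n.+1%:R^-1 by have [] := uS n.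
(* Parallelogram identity at the midpoint, where [J] is at least [m]: minimizing sequences are
   Cauchy. *)
have par g h : S g -> S h -> B (g - h) (g - h) <= 2 * (J g + J h - 2 * m).
  move=> Sg Sh; have Sgh := si_D HS Sg Sh.
  have := mJ (2^-1 *: (g + h)) (si_Z HS _ Sgh).
  rewrite /J (si_sqZ HS)// lZ// lD// (si_sqB HS)//.
  have := si_sqDZ HS 1 Sg Sh; rewrite scale1r => ->.
  have -> : 2^-1 ^+ 2 = 4^-1 :> R by field.
  lra.
have Du n : D (u n) by exact: SD.
have [e e0|f Df uf] := Bc u Du.
  have e40 : 0 < e / 4 by rewrite divr_gt0.
  have [N HN] := harmonic_small e40.
  exists N => p q Np Nq; apply: le_lt_trans (par _ _ (Su p) (Su q)) _.
  move: (uJ p) (uJ q) (HN _ Np) (HN _ Nq).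
  by move: (J (u p)) (J (u q)) p.+1%:R^-1 q.+1%:R^-1 => a b c d; lra.
exists f; split => //.
- move=> g Sg; have Dg := SD _ Sg.
  have c1 := si_cvg_l hB Du Df Dg uf.
  suff c2 : (fun n => B (u n) g) @ \oo --> l g by exact: cvg_unique c1 c2.
  (* First-order condition with an error: [J (u n + s g) >= m > J (u n) - 1/(n+1)] for every [s],
     which is a nonnegative quadratic in [s]. *)
  have bd n : (B (u n) g - l g) ^+ 2 <= n.+1%:R^-1 * B g g.
    apply: discriminant_le => [|s]; first exact: (si_ge0 HS).
    have Ssg := si_Z HS s Sg.
    have H1 := mJ _ (si_D HS (Su n) Ssg); have H2 := uJ n.
    rewrite /J (si_sqDZ HS (s) (Su n) Sg) (lD _ _ (Su n) Ssg) (lZ _ _ Sg) in H1.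
    rewrite /J in H2; move: n.+1%:R^-1 H1 H2 => k H1 H2.
    by lra.
  apply/cvgrPdist_lt => e e0.
  have G0 := si_ge0 HS Sg.
  have [|N HN] := @harmonic_small _ (e ^+ 2 / (B g g + 1)).
    by rewrite divr_gt0 ?exprn_gt0//; lra.
  exists N => // n /= Nn; rewrite distrC.
  apply: normr_lt_sqr; first exact: ltW.
  apply: le_lt_trans (bd n) _.
  have := HN _ Nn; rewrite ltr_pdivlMr; last by apply: ltr_wpDl.
  by apply: le_lt_trans; rewrite ler_wpM2l ?invr_ge0// lerDl.
- move=> e e0.
  move/cvgrPdist_lt: uf => /(_ _ e0)[N _ /(_ N (leqnn N))].
  rewrite sub0r normrN ger0_norm; last by apply: (si_ge0 hB); exact: (si_B hB).
  move=> H; exists (u N) => //.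
  by rewrite (si_sqC hB Df (Du N)).
Qed.

(** * Semigroup and resolvent of a closed form *)

Lemma semi_inner_comb (R : realType) (V : lmodType R) (D : set V)
    (B1 B2 : V -> V -> R) (h : R) : 0 <= h ->
  semi_inner D B1 -> semi_inner D B2 ->
  semi_inner D (fun f g => B1 f g + h * B2 f g).
Proof.
move=> h0 H1 H2; split.
- exact: (si_zero H1).
- exact: (si_lin H1).
- by move=> f g Df Dg; rewrite (si_sym H1)// (si_sym H2).
- by move=> c f g k Df Dg Dk; rewrite (si_bilin H1)// (si_bilin H2)//; ring.
- by move=> f Df; rewrite addr_ge0 ?mulr_ge0 ?(si_ge0 H1) ?(si_ge0 H2).
Qed.

Lemma semi_inner_sub (R : realType) (V : lmodType R) (D S : set V)
    (B : V -> V -> R) : semi_inner D B -> S `<=` D -> S 0 ->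
  (forall c f g, S f -> S g -> S (c *: f + g)) -> semi_inner S B.
Proof.
move=> hB SD S0 Slin; split=> //.
- by move=> f g /SD Df /SD Dg; exact: (si_sym hB).
- by move=> c f g h /SD Df /SD Dg /SD Dh; exact: (si_bilin hB).
- by move=> f /SD; exact: (si_ge0 hB).
Qed.

Lemma cauchy_seq_cvg (R : realType) (V : completeNormedModType R) (u : nat -> V) :
  (forall e : R, 0 < e -> exists N, forall m n, (N <= m)%N -> (N <= n)%N ->
     `|u m - u n| < e) -> cvgn u.
Proof.
move=> H; apply: cauchy_cvg; apply: cauchy_exP => e e0.
have [N HN] := H _ e0; exists (u N); rewrite /fmap /=.
exists N => // n /= Nn; rewrite -ball_normE /=; exact: HN.
Qed.

Record inner_product (R : realType) (V : normedModType R) (dot : V -> V -> R)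
    : Prop := InnerProduct {
  ip_sym : forall f g, dot f g = dot g f;
  ip_bilin : forall c f g h, dot (c *: f + g) h = c * dot f h + dot g h;
  ip_norm : forall f, dot f f = `|f| ^+ 2 }.

Record closed_form (R : realType) (V : normedModType R) (dot : V -> V -> R)
    (Dom : set V) (E : V -> V -> R) : Prop := ClosedForm {
  cf_si : semi_inner Dom E;
  cf_dense : forall f e, 0 < e -> exists2 g, Dom g & `|f - g| < e;
  cf_complete : si_complete Dom (fun f g => dot f g + E f g) }.

Definition form_gen (R : realType) (V : normedModType R) (dot : V -> V -> R)
    (Dom : set V) (E : V -> V -> R) (f g : V) : Prop :=
  Dom f /\ forall k, Dom k -> E f k = - dot g k.

Record contraction (R : realType) (V : normedModType R) (P : V -> V) : Prop :=
  Contraction {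
  ct_lin : forall c f g, P (c *: f + g) = c *: P f + P g;
  ct_le : forall f, `|P f| <= `|f| }.

(** * Linear contractions of a normed space *)

Section contraction_theory.
Context (R : realType) (V : normedModType R).
Implicit Types P Q : V -> V.

Lemma ctD P f g : contraction P -> P (f + g) = P f + P g.
Proof. by move=> cP; have := ct_lin cP 1 f g; rewrite !scale1r. Qed.

Lemma ct0 P : contraction P -> P 0 = 0.
Proof.
move=> cP; apply/eqP; rewrite -normr_le0.
by apply: le_trans (ct_le cP 0) _; rewrite normr0.
Qed.

Lemma ctZ P c f : contraction P -> P (c *: f) = c *: P f.
Proof. by move=> cP; have := ct_lin cP c f 0; rewrite !addr0 (ct0 cP) addr0. Qed.

Lemma ctB P f g : contraction P -> P (f - g) = P f - P g.
Proof. by move=> cP; rewrite (ctD _ _ cP) -scaleN1r (ctZ _ _ cP) scaleN1r. Qed.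

Lemma ct_iter P n : contraction P -> contraction (iter n P).
Proof.
move=> cP; elim: n => [|n IH]; first by split.
split=> [c f g|f] /=; first by rewrite (ct_lin IH) (ct_lin cP).
exact: le_trans (ct_le cP _) (ct_le IH _).
Qed.

Lemma ct_comp P Q : contraction P -> contraction Q -> contraction (P \o Q).
Proof.
move=> cP cQ; split=> [c f g|f] /=; first by rewrite (ct_lin cQ) (ct_lin cP).
exact: le_trans (ct_le cP _) (ct_le cQ _).
Qed.

Lemma iter_comm P Q n f : (forall g, P (Q g) = Q (P g)) ->
  iter n P (Q f) = Q (iter n P f).
Proof. by move=> PQ; elim: n => //= n ->. Qed.

(** [P^n - Q^n] is the sum of the [P^k (P - Q) Q^(n-1-k)]; commutation lets [P - Q] act on [f]
    first, and the remaining factors contract. This turns one-step errors into global ones. *)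
Lemma iter_telescope P Q n f : contraction P -> contraction Q ->
  (forall g, P (Q g) = Q (P g)) ->
  `|iter n P f - iter n Q f| <= n%:R * `|P f - Q f|.
Proof.
move=> cP cQ PQ; elim: n => [|n IH]; first by rewrite subrr normr0 mul0r.
rewrite iterSr [iter n.+1 Q f]iterS -(subrKA (iter n P (Q f))).
apply: le_trans (ler_normD _ _) _.
rewrite -(ctB _ _ (ct_iter n cP)) (iter_comm _ _ PQ) -(ctB _ _ cQ).
rewrite -natr1 mulrDl mul1r addrC lerD//.
  exact: le_trans (ct_le cQ _) IH.
exact: (ct_le (ct_iter n cP)).
Qed.

Lemma ct_cvg P (u : nat -> V) f : contraction P -> u @ \oo --> f ->
  (fun n => P (u n)) @ \oo --> P f.
Proof.
move=> cP /cvgrPdist_lt uf; apply/cvgrPdist_lt => e /uf.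
by apply: filterS => n; apply: le_lt_trans; rewrite -(ctB _ _ cP) (ct_le cP).
Qed.

Lemma ct_eq_dense P Q (S : set V) : contraction P -> contraction Q ->
  (forall f e, 0 < e -> exists2 g, S g & `|f - g| < e) ->
  (forall g, S g -> P g = Q g) -> forall f, P f = Q f.
Proof.
move=> cP cQ dS PQ f; apply/eqP; rewrite -subr_eq0 -normr_le0.
apply/ler_addgt0Pl => e e0; rewrite addr0.
have [g Sg fg] := dS f (e / 2) (divr_gt0 e0 (ltr0n _ 2)).
have := ler_normD (P f - P g) (P g - Q f); rewrite subrKA.
have := ct_le cQ (g - f); rewrite (ctB _ _ cQ) -(PQ _ Sg) (distrC g).
have := ct_le cP (f - g); rewrite (ctB _ _ cP); lra.
Qed.

End contraction_theory.

(** Equicontinuity: an approximation of [f] by [g] in [S] costs the same at all indices. *)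
Lemma contractions_cvg (R : realType) (V : completeNormedModType R)
    (P : nat -> V -> V) (S : set V) : (forall n, contraction (P n)) ->
  (forall f e, 0 < e -> exists2 g, S g & `|f - g| < e) ->
  (forall g, S g -> cvgn (P ^~ g)) -> forall f, cvgn (P ^~ f).
Proof.
move=> cP dS PS f; apply: cauchy_seq_cvg => e e0.
have e40 : 0 < e / 4 by rewrite divr_gt0.
have [g Sg fg] := dS f _ e40.
have /cvg_ex[l /cvgrPdist_lt/(_ _ e40)[N _ HN]] := PS _ Sg.
exists N => m n Nm Nn.
have := HN _ Nm; have := HN _ Nn => /=.
have := ct_le (cP m) (f - g); have := ct_le (cP n) (f - g).
rewrite (ctB _ _ (cP m)) (ctB _ _ (cP n)).
rewrite -[P m f - P n f](subrKA (P m g)) -[P m g - P n f](subrKA l).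
rewrite -[l - P n f](subrKA (P n g)) (distrC (P n f)) (distrC l (P m g)) => h1 h2 h3 h4.
have := ler_normD (P m f - P m g) (P m g - l + (l - P n g + (P n g - P n f))).
have := ler_normD (P m g - l) (l - P n g + (P n g - P n f)).
have := ler_normD (l - P n g) (P n g - P n f).
lra.
Qed.

Section hilbert.
Context (R : realType) (V : completeNormedModType R) (dot : V -> V -> R).
Hypothesis ip : inner_product dot.

Lemma ip_si : semi_inner [set: V] dot.
Proof.
split=> //.
- by move=> f g _ _; exact: (ip_sym ip).
- by move=> c f g h _ _ _; exact: (ip_bilin ip).
- by move=> f _; rewrite (ip_norm ip) sqr_ge0.
Qed.

Lemma dotBl f g h : dot (f - g) h = dot f h - dot g h.
Proof. exact: (siBl ip_si). Qed.
Lemma dotBr f g h : dot h (f - g) = dot h f - dot h g.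
Proof. exact: (siBr ip_si). Qed.
Lemma dotDl f g h : dot (f + g) h = dot f h + dot g h.
Proof. exact: (siDl ip_si). Qed.
Lemma dotZl c f h : dot (c *: f) h = c * dot f h.
Proof. exact: (siZl ip_si). Qed.

Lemma dot_CS f g : `|dot f g| <= `|f| * `|g|.
Proof.
by have := si_CS_abs ip_si (I : setT f) (I : setT g);
  rewrite !(ip_norm ip) !sqrtr_sqr !normr_id.
Qed.

Lemma dot_cvgl (u : nat -> V) f g : u @ \oo --> f ->
  (fun n => dot (u n) g) @ \oo --> dot f g.
Proof.
move=> uf; apply: (si_cvg_l ip_si) => //.
have -> : (fun n => dot (u n - f) (u n - f)) = (fun n => `|u n - f| * `|u n - f|).
  by apply/funext => n; rewrite (ip_norm ip) expr2.
have h : (fun n => `|u n - f|) @ \oo --> 0.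
  by rewrite -(normr0 V) -(subrr f); apply: cvg_norm; apply: cvgB => //; exact: cvg_cst.
by rewrite -[0 in X in _ --> X](mulr0 0); exact: cvgM.
Qed.

Lemma dot_cvgr (u : nat -> V) f g : u @ \oo --> f ->
  (fun n => dot g (u n)) @ \oo --> dot g f.
Proof.
move=> uf; rewrite (ip_sym ip); under eq_fun do rewrite (ip_sym ip).
exact: dot_cvgl.
Qed.

Lemma dot_cvg (u v : nat -> V) f g : u @ \oo --> f -> v @ \oo --> g ->
  (fun n => dot (u n) (v n)) @ \oo --> dot f g.
Proof.
have dotE x y : dot x y = 2^-1 * (`|x + y| * `|x + y| - `|x| * `|x| - `|y| * `|y|).
  have := si_sqDZ ip_si 1 (I : setT x) (I : setT y); rewrite scale1r !(ip_norm ip).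
  by rewrite -!expr2 => ->; field.
move=> uf vg; rewrite dotE; under eq_fun do rewrite dotE.
apply: cvgMl_tmp; apply: cvgB; last by apply: cvgM; exact: cvg_norm.
apply: cvgB; last by apply: cvgM; exact: cvg_norm.
by apply: cvgM; apply: cvg_norm; exact: cvgD.
Qed.

Lemma dotNl f h : dot (- f) h = - dot f h.
Proof. by rewrite -scaleN1r dotZl mulN1r. Qed.

Lemma dot_ext f g : (forall h, dot f h = dot g h) -> f = g.
Proof.
move=> H; apply/eqP; rewrite -subr_eq0 -normr_eq0 -sqrf_eq0 -(ip_norm ip).
by rewrite dotBl H subrr.
Qed.

Lemma dot_eq0 f : (forall g, dot g f = 0) -> f = 0.
Proof.
by move=> /(_ f); rewrite (ip_norm ip) => /eqP; rewrite sqrf_eq0 normr_eq0 => /eqP.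
Qed.

(* Two vectors are equal when they have the same products with every vector. *)
Ltac vring := apply: dot_ext => ?;
  rewrite ?(dotDl, dotBl, dotZl, dotNl); ring.

(** * Resolvent and generator of a closed form *)

Section resolvent.
Context (Dom : set V) (E : V -> V -> R).
Hypothesis cf : closed_form dot Dom E.
Let hE := cf_si cf.

Lemma dot_si_dom : semi_inner Dom dot.
Proof. by apply: (semi_inner_sub ip_si) => //; [exact: (si_zero hE)|exact: (si_lin hE)]. Qed.

Lemma Eh_si h : 0 <= h -> semi_inner Dom (fun f g => dot f g + h * E f g).
Proof. by move=> h0; apply: semi_inner_comb => //; exact: dot_si_dom. Qed.

Lemma E1_si : semi_inner Dom (fun f g => dot f g + E f g).
Proof.
have := Eh_si ler01; congr semi_inner.
by apply/funext => f; apply/funext => g; rewrite mul1r.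
Qed.

Lemma Eh_complete h : 0 < h -> si_complete Dom (fun f g => dot f g + h * E f g).
Proof.
move=> h0 u Du uc.
(* With [x] the energy and [y] the squared norm, [y + x <= (1 + h^-1) (y + h x)] and
   [y + h x <= (1 + h) (y + x)]: the norms for [h] and for 1 are equivalent. *)
have C0 : 0 < 1 + h^-1 by rewrite addr_gt0 ?invr_gt0.
have [e e0|f Df uf] := cf_complete cf Du.
  have [N HN] := uc (e / (1 + h^-1)) (divr_gt0 e0 C0).
  exists N => m n Nm Nn; have := HN m n Nm Nn.
  rewrite ltr_pdivlMr//; apply: le_lt_trans.
  have Dmn := si_B hE (Du m) (Du n).
  have := si_ge0 dot_si_dom Dmn; have := si_ge0 hE Dmn.
  set x := E _ _; set y := dot _ _ => x0 y0.
  have -> : (y + h * x) * (1 + h^-1) = y + x + h * x + y * h^-1 by field; lra.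
  have : 0 <= h * x by apply: mulr_ge0 => //; exact: ltW.
  have : 0 <= y * h^-1 by rewrite mulr_ge0// invr_ge0 ltW.
  lra.
exists f => //.
apply: (@squeeze_cvgr _ _ _ _ (fun=> 0)
  (fun n => (dot (u n - f) (u n - f) + E (u n - f) (u n - f)) * (1 + h))).
- near=> n; have Duf := si_B hE (Du n) Df.
  have := si_ge0 dot_si_dom Duf; have := si_ge0 hE Duf.
  by set x := E _ _; set y := dot _ _ => x0 y0; apply/andP; split; nra.
- exact: cvg_cst.
- by rewrite -[0 in X in _ --> X](mul0r (1 + h)); apply: cvgMr_tmp.
Unshelve. all: by end_near. Qed.

(* [(1 - h A)^-1] for [0 < h]; the value [f] for [h <= 0] makes the estimates
   below uniform in [0 <= h]. *)
Definition resolvent (h : R) (f : V) : V :=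
  if 0 < h then
    xget 0 [set u | Dom u /\ forall g, Dom g -> dot u g + h * E u g = dot f g]
  else f.
Local Notation J := resolvent.
Local Notation gen := (form_gen dot Dom E).

Lemma resolvent_spec h f : 0 < h ->
  Dom (J h f) /\ forall g, Dom g -> dot (J h f) g + h * E (J h f) g = dot f g.
Proof.
move=> h0; rewrite /J h0.
have [||||||u [Du uP _]] := @riesz _ _ Dom Dom _ (dot f) (`|f| ^+ 2)
  (Eh_si (ltW h0)) (Eh_complete h0).
- exact: sqr_ge0.
- by [].
- exact: (si_zero hE).
- exact: (si_lin hE).
- by move=> c g k _ _; rewrite !(ip_sym ip f) (ip_bilin ip).
- move=> g Dg; apply: le_trans (si_CS ip_si I I) _.
  rewrite (ip_norm ip f) ler_wpM2l ?sqr_ge0// lerDl mulr_ge0//; first exact: ltW.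
  exact: (si_ge0 hE).
pose A := [set u | Dom u /\ forall g, Dom g -> dot u g + h * E u g = dot f g].
exact: (@xgetPex _ 0 A (ex_intro _ u (conj Du uP))).
Qed.

Lemma resolvent_dom h f : 0 < h -> Dom (J h f).
Proof. by move=> /resolvent_spec -/(_ f)[]. Qed.

Lemma resolventE h f g : 0 < h -> Dom g ->
  dot (J h f) g + h * E (J h f) g = dot f g.
Proof. by move=> /resolvent_spec -/(_ f)[_]; exact. Qed.

Lemma resolvent_uniq h f u : 0 < h -> Dom u ->
  (forall g, Dom g -> dot u g + h * E u g = dot f g) -> J h f = u.
Proof.
move=> h0 Du uP; apply/eqP; rewrite -subr_eq0 -normr_eq0 -sqrf_eq0.
have DJ := resolvent_dom f h0; have Dw := si_B hE DJ Du.
have := siBl (Eh_si (ltW h0)) DJ Du Dw; rewrite resolventE// uP// subrr.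
rewrite (ip_norm ip); set x := `|_| ^+ 2.
have := si_ge0 hE Dw; set y := E _ _ => y0.
have : 0 <= x by exact: sqr_ge0.
have : 0 <= h * y by rewrite mulr_ge0// ltW.
by move=> a b c; apply/eqP; lra.
Qed.

(** Testing the defining equation against [J h f] itself gives [|J h f|^2 <= <f, J h f>]. *)
Lemma resolvent_ct h : contraction (J h).
Proof.
have [h0|h0] := ltP 0 h; last first.
  by split; rewrite /J ltNge h0.
split=> [c f g|f].
  have Df := resolvent_dom f h0; have Dg := resolvent_dom g h0.
  apply: resolvent_uniq => //; first exact: (si_lin hE).
  move=> k Dk; rewrite (si_bilin (Eh_si (ltW h0)))// !resolventE//.
  by rewrite (ip_bilin ip).
have Df := resolvent_dom f h0.
have := resolventE f h0 Df; have := dot_CS f (J h f).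
have := si_ge0 hE Df; rewrite (ip_norm ip); set x := E _ _ => x0.
have : 0 <= h * x by rewrite mulr_ge0// ltW.
move=> a b c; have := le_trans (ler_norm _) b; rewrite -c.
have := normr_ge0 (J h f); have := normr_ge0 f.
by move: `|J h f| `|f| => p q; nra.
Qed.

Lemma resolvent_sym h f g : dot (J h f) g = dot f (J h g).
Proof.
have [h0|h0] := ltP 0 h; last by rewrite /J ltNge h0.
have Df := resolvent_dom f h0; have Dg := resolvent_dom g h0.
rewrite -(resolventE f h0 Dg) (ip_sym ip _ g) -(resolventE g h0 Df).
by rewrite (ip_sym ip (J h g)) (si_sym hE Df Dg).
Qed.

Lemma gen_lin c f g f' g' : gen f g -> gen f' g' ->
  gen (c *: f + f') (c *: g + g').
Proof.
move=> [Df fg] [Df' fg']; split; first exact: (si_lin hE).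
move=> k Dk; rewrite (si_bilin hE)// fg// fg'// (ip_bilin ip); ring.
Qed.

Lemma gen_resolvent h f : 0 < h -> gen (J h f) (h^-1 *: (J h f - f)).
Proof.
move=> h0; have Df := resolvent_dom f h0; split=> // k Dk.
rewrite dotZl dotBl -(resolventE f h0 Dk); field; lra.
Qed.

Lemma resolvent_gen h f g : 0 <= h -> gen f g -> J h (f - h *: g) = f.
Proof.
rewrite le_eqVlt => /orP[/eqP <-|h0] [Df fg].
  by rewrite /J ltxx scale0r subr0.
apply: resolvent_uniq => // k Dk; rewrite fg// dotBl dotZl; ring.
Qed.

(** The source of the error estimates below: an increment of the resolvent is [h] times a
    contraction of [A f]. *)
Lemma resolvent_genE h f g : 0 <= h -> gen f g -> J h f - f = h *: J h g.
Proof.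
move=> h0 fg; have := resolvent_gen h0 fg.
rewrite (ctB _ _ (resolvent_ct h)) (ctZ _ _ (resolvent_ct h)).
by move=> /(congr1 (fun x => x + h *: J h g)); rewrite subrK => ->; rewrite addrAC subrr add0r.
Qed.

Lemma gen_resolvent2 h f g : 0 <= h -> gen f g -> gen (J h f) (J h g).
Proof.
rewrite le_eqVlt => /orP[/eqP <-|h0] fg; first by rewrite /J ltxx.
have := gen_resolvent f h0.
by rewrite (resolvent_genE (ltW h0) fg) scalerA mulVf ?scale1r// gt_eqF.
Qed.

Lemma resolvent_comm h k f : 0 <= h -> 0 <= k -> J h (J k f) = J k (J h f).
Proof.
rewrite le_eqVlt => /orP[/eqP <-|h0]; first by rewrite /J ltxx.
rewrite le_eqVlt => /orP[/eqP <-|k0]; first by rewrite /J ltxx.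
have fg := gen_resolvent f h0; set g := _ *: _ in fg.
have gg := gen_resolvent2 (ltW k0) fg.
rewrite -[RHS](resolvent_gen (ltW h0) gg) -(ctZ _ _ (resolvent_ct k)).
rewrite -(ctB _ _ (resolvent_ct k)); congr (J h (J k _)).
by rewrite /g scalerA divff ?gt_eqF// scale1r opprB addrC subrK.
Qed.

(** The range of [J 1] is a core. Let [u] be the projection of [f] on its closure for [dot + E];
    then [f - u] is orthogonal to each [J 1 v], and the product of [J 1 v] with [f - u] for
    [dot + E] is [<v, f - u>], so that [f = u]. *)
Lemma gen_form_dense f : Dom f -> forall e, 0 < e -> exists u g,
  gen u g /\ dot (f - u) (f - u) + E (f - u) (f - u) < e.
Proof.
move=> Df; pose S := [set J 1 v | v in [set: V]].
have E1 := E1_si.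
have SD : S `<=` Dom by move=> _ [v _ <-]; exact: resolvent_dom.
have [||||||u [Du uP uS]] := @riesz _ _ Dom S _ (fun g => dot f g + E f g)
  (dot f f + E f f) E1 (cf_complete cf).
- exact: (si_ge0 E1).
- exact: SD.
- by exists 0 => //; exact: (ct0 (resolvent_ct 1)).
- move=> c _ _ [v _ <-] [w _ <-]; exists (c *: v + w) => //.
  exact: (ct_lin (resolvent_ct 1)).
- move=> c x y /SD Dx /SD Dy /=.
  by rewrite (si_sym E1 Df (si_lin hE c Dx Dy)) (si_bilin E1)// !(si_sym E1 _ Df).
- by move=> g /SD Dg; exact: (si_CS E1).
suff fu : f = u.
  move=> e e0; have [_ [v _ <-]] := uS _ e0; rewrite -fu => H.
  by exists (J 1 v), (1^-1 *: (J 1 v - v)); split => //; exact: gen_resolvent.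
apply/eqP; rewrite -subr_eq0; apply/eqP; apply: dot_eq0 => v.
have Dfu := si_B hE Df Du; have DJ := resolvent_dom v ltr01.
rewrite -(resolventE v ltr01 Dfu) mul1r.
rewrite (si_sym E1 DJ Dfu) (siBl E1)//; apply/eqP; rewrite subr_eq0; apply/eqP.
by rewrite uP//; exists v.
Qed.

Lemma gen_dense f e : 0 < e -> exists2 u, exists g, gen u g & `|f - u| < e.
Proof.
move=> e0; have e20 : 0 < e / 2 by rewrite divr_gt0.
have [g Dg fg] := cf_dense cf f e20.
have [u [k [uk H]]] := gen_form_dense Dg (exprn_gt0 2 e20).
exists u; first by exists k.
have Du : Dom u by case: uk.
have : `|g - u| < e / 2.
  rewrite -[`|_|]normr_id; apply: normr_lt_sqr; first exact: ltW.
  apply: le_lt_trans H; rewrite -(ip_norm ip) lerDl (si_ge0 hE)//.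
  exact: (si_B hE).
by have := ler_normD (f - g) (g - u); rewrite subrKA; lra.
Qed.

(* The domain of [A^2], on which [(1 - h A)^(-m)] is [1 + m h A] up to an error
   [(m h)^2]. *)
Definition gen2_dom : set V := [set u | exists g k, gen u g /\ gen g k].

(** If [gen u g], then [u = J 1 (u - g)]. Replacing [u - g] by a nearby [w] of the domain of [A]
    puts [J 1 w] into the domain of [A^2], and [J 1] does not enlarge the error. *)
Lemma gen2_dense f e : 0 < e -> exists2 u, gen2_dom u & `|f - u| < e.
Proof.
move=> e0; have e20 : 0 < e / 2 by rewrite divr_gt0.
have [u [g ug] fu] := gen_dense f e20.
have [w [w' ww'] H] := gen_dense (u - g) e20.
exists (J 1 w).
  exists (J 1 w'), (1^-1 *: (J 1 w' - w')); split.
    exact: gen_resolvent2.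
  exact: gen_resolvent.
have := resolvent_gen ler01 ug; rewrite scale1r => uE.
have := ct_le (resolvent_ct 1) (u - g - w); rewrite (ctB _ _ (resolvent_ct 1)) uE => H2.
by have := ler_normD (f - u) (u - J 1 w); rewrite subrKA; lra.
Qed.

Lemma resolvent_est1 h f g : 0 <= h -> gen f g -> `|J h f - f| <= h * `|g|.
Proof.
move=> h0 fg; rewrite (resolvent_genE h0 fg) normrZ ger0_norm// ler_wpM2l//.
exact: (ct_le (resolvent_ct h)).
Qed.

Lemma iter_resolvent_est1 h m f g : 0 <= h -> gen f g ->
  `|iter m (J h) f - f| <= m%:R * h * `|g|.
Proof.
move=> h0 fg; have cI : contraction (@idfun V) by split.
have := iter_telescope m f (resolvent_ct h) cI (fun _ => erefl).
have -> : iter m idfun f = f by elim: m => //= m ->.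
move=> H; apply: le_trans H _; rewrite -mulrA ler_wpM2l//; exact: resolvent_est1.
Qed.

(** Each step adds [h (J^(m+1) g - g)], of norm at most [(m + 1) h^2 |k|], and
    [m^2 + (m + 1) <= (m + 1)^2]. *)
Lemma iter_resolvent_est2 h m f g k : 0 <= h -> gen f g -> gen g k ->
  `|iter m (J h) f - f - (m%:R * h) *: g| <= (m%:R * h) ^+ 2 * `|k|.
Proof.
move=> h0 fg gk; elim: m => [|m IH].
  by rewrite mul0r scale0r !subr0 /= subrr normr0 expr0n mul0r.
have -> : iter m.+1 (J h) f - f - (m.+1%:R * h) *: g =
    (iter m (J h) f - f - (m%:R * h) *: g) + h *: (iter m.+1 (J h) g - g).
  have := resolvent_genE h0 fg => /(congr1 (iter m (J h))).
  rewrite (ctB _ _ (ct_iter m (resolvent_ct h))) (ctZ _ _ (ct_iter m (resolvent_ct h))).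
  rewrite -!iterSr => H; rewrite scalerBr -H -natr1 mulrDl mul1r scalerDl.
  set x := iter m _ f; set y := iter _ _ f; set a := _ *: g; set b := _ *: g.
  by vring.
have H := iter_resolvent_est1 m.+1 h0 gk.
apply: le_trans (ler_normD _ _) _.
rewrite normrZ (ger0_norm h0).
have := ler_wpM2l h0 H; rewrite -natr1.
have m0 : 0 <= m%:R :> R by [].
have k0 := normr_ge0 k.
have : 0 <= m%:R * h ^+ 2 * `|k| by rewrite !mulr_ge0// exprn_ge0.
move: IH; move: `|k| `|_| `|_| m%:R => K x y M IH p q; nra.
Qed.

(** One step of length [h] and [m + 1] steps of length [h / (m + 1)] both agree with [f + h g] up to
    [h^2 |k|]. *)
Lemma resolvent_refine h m f g k : 0 <= h -> gen f g -> gen g k ->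
  `|J h f - iter m.+1 (J (h / m.+1%:R)) f| <= 2 * h ^+ 2 * `|k|.
Proof.
move=> h0 fg gk; have hm0 : 0 <= h / m.+1%:R by rewrite divr_ge0.
have := iter_resolvent_est2 m.+1 hm0 fg gk.
have := iter_resolvent_est2 1 h0 fg gk; rewrite mul1r /=.
have -> : m.+1%:R * (h / m.+1%:R) = h by rewrite mulrC divfK// pnatr_eq0.
set x := J h f; set y := J _ _; rewrite -/x => H1 H2.
have := ler_normB (x - f - h *: g) (y - f - h *: g).
have -> : x - f - h *: g - (y - f - h *: g) = x - y by vring.
lra.
Qed.

(** Consistency of a composite step with a single step of length [a + b]; the semigroup law rests on
    it. *)
Lemma resolvent_comp_est a b f g k : 0 <= a -> 0 <= b -> gen f g -> gen g k ->
  `|J a (J b f) - f - (a + b) *: g| <= (a + b) ^+ 2 * `|k|.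
Proof.
move=> a0 b0 fg gk.
have -> : J a (J b f) - f - (a + b) *: g =
    b *: (J a (J b g) - g) + a *: (J a g - g).
  have := resolvent_genE b0 fg => /(congr1 (J a)).
  rewrite (ctB _ _ (resolvent_ct a)) (ctZ _ _ (resolvent_ct a)) => H1.
  have H2 := resolvent_genE a0 fg.
  rewrite !scalerBr -H1 -H2 scalerDl.
  set x := J a (J b f); set y := J a f.
  by vring.
have := resolvent_est1 a0 gk; have H3 := resolvent_est1 b0 gk.
have := ct_le (resolvent_ct a) (J b g - g); rewrite (ctB _ _ (resolvent_ct a)).
have := ler_normD (J a (J b g) - J a g) (J a g - g); rewrite subrKA => H4 H5 H6.
apply: le_trans (ler_normD _ _) _; rewrite !normrZ !ger0_norm//.
have H7 : `|J a (J b g) - g| <= (a + b) * `|k| by lra.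
have := ler_wpM2l a0 H6; have := ler_wpM2l b0 H7.
have : 0 <= a * b * `|k| by rewrite !mulr_ge0.
have : 0 <= a * a * `|k| by rewrite !mulr_ge0.
lra.
Qed.

(** * Post-Widder approximation and its limit; index [n] stands for [n + 1] steps *)

Definition post_widder (t : R) (n : nat) : V -> V :=
  iter n.+1 (J (t / n.+1%:R)).

Lemma post_widder_ct t n : contraction (post_widder t n).
Proof. exact: ct_iter (resolvent_ct _). Qed.

(** Each of the [n + 1] steps is cut into [m + 1]. The local error [2 (t / (n + 1))^2 |k|] is
    multiplied by [n + 1] through telescoping. The predecessor compensates the shift of the
    index. *)
Lemma post_widder_refine t n m f g k : 0 <= t -> gen f g -> gen g k ->
  `|post_widder t n f - post_widder t (n.+1 * m.+1).-1 f| <=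
  2 * t ^+ 2 * `|k| * n.+1%:R^-1.
Proof.
move=> t0 fg gk; rewrite /post_widder prednK ?muln_gt0//.
have tn0 : 0 <= t / n.+1%:R by rewrite divr_ge0.
have tnm0 : 0 <= t / n.+1%:R / m.+1%:R by rewrite divr_ge0.
have -> : t / (n.+1 * m.+1)%:R = t / n.+1%:R / m.+1%:R.
  by rewrite natrM invfM mulrA.
rewrite iterM.
apply: le_trans (iter_telescope _ _ (resolvent_ct _)
  (ct_iter m.+1 (resolvent_ct _)) _) _.
  move=> x; rewrite iter_comm// => y; exact: resolvent_comm.
have := resolvent_refine m tn0 fg gk => H.
apply: le_trans (ler_wpM2l _ H) _ => //.
rewrite le_eqVlt; apply/orP; left; apply/eqP; field.
by rewrite addrC natr1 pnatr_eq0.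
Qed.

(** Two subdivisions are compared through their common refinement into [(n + 1) (m + 1)] steps. *)
Lemma post_widder_dist t n m f g k : 0 <= t -> gen f g -> gen g k ->
  `|post_widder t n f - post_widder t m f| <=
  2 * t ^+ 2 * `|k| * (n.+1%:R^-1 + m.+1%:R^-1).
Proof.
move=> t0 fg gk.
have := post_widder_refine n m t0 fg gk; have := post_widder_refine m n t0 fg gk.
rewrite mulnC; set z := post_widder t _.-1 f; rewrite distrC => H1 H2.
have := ler_distD z (post_widder t n f) (post_widder t m f).
by move: H1 H2; move: n.+1%:R^-1 m.+1%:R^-1 => p q; lra.
Qed.

Lemma post_widder_cvg t f : 0 <= t -> cvgn (fun n => post_widder t n f).
Proof.
move=> t0; apply: (contractions_cvg (post_widder_ct t) gen2_dense) => {f}.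
move=> f [g [k [fg gk]]]; apply: cauchy_seq_cvg => e e0.
pose C := 2 * t ^+ 2 * `|k| + 1.
have C0 : 0 < C by rewrite /C ltr_wpDl// !mulr_ge0// exprn_ge0.
have [N HN] := harmonic_small (divr_gt0 e0 (mulr_gt0 C0 (ltr0n _ 2))).
exists N => m n Nm Nn; apply: le_lt_trans (post_widder_dist m n t0 fg gk) _.
have := HN _ Nm; have := HN _ Nn.
rewrite !ltr_pdivlMr ?mulr_gt0//.
have : 0 <= m.+1%:R^-1 :> R by rewrite invr_ge0.
have : 0 <= n.+1%:R^-1 :> R by rewrite invr_ge0.
move: m.+1%:R^-1 n.+1%:R^-1 => p q q0 p0 h1 h2.
have : (p + q) * C < e by lra.
by rewrite /C mulrDr mulr1 mulrC; lra.
Qed.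

Definition form_semigroup (t : R) (f : V) : V :=
  limn (fun n => post_widder t n f).
Local Notation T := form_semigroup.

Lemma form_semigroup_cvg t f : 0 <= t ->
  (fun n => post_widder t n f) @ \oo --> T t f.
Proof. by move=> t0; exact: post_widder_cvg. Qed.
Arguments form_semigroup_cvg {t} f.

Lemma norm_lim_le (u : nat -> V) l x (c : R) : u @ \oo --> l ->
  (forall n, `|u n - x| <= c) -> `|l - x| <= c.
Proof.
move=> ul H.
have : (fun n => `|u n - x|) @ \oo --> `|l - x|.
  by apply: cvg_norm; apply: cvgB => //; exact: cvg_cst.
by move=> /cvgr_to_le; apply; apply: nearW.
Qed.

Lemma form_semigroup_ct t : 0 <= t -> contraction (T t).
Proof.
move=> t0; split=> [c f g|f].
  have h : (fun n => c *: post_widder t n f + post_widder t n g) @ \oo -->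
      c *: T t f + T t g.
    apply: cvgD; last exact: form_semigroup_cvg.
    by apply: cvgZl_tmp; exact: form_semigroup_cvg.
  have hE' : (fun n => c *: post_widder t n f + post_widder t n g) =
      fun n => post_widder t n (c *: f + g).
    by apply/funext => n; rewrite (ct_lin (post_widder_ct t n)).
  rewrite hE' in h.
  exact: cvg_unique (form_semigroup_cvg _ t0) h.
rewrite -[T t f]subr0; apply: (norm_lim_le (form_semigroup_cvg f t0)) => n.
by rewrite subr0; exact: (ct_le (post_widder_ct t n)).
Qed.

Lemma iter_resolvent_sym h m f g : dot (iter m (J h) f) g = dot f (iter m (J h) g).
Proof. by elim: m f g => // m IH f g; rewrite iterS resolvent_sym IH iterSr. Qed.

Lemma form_semigroup_sym t f g : 0 <= t -> dot (T t f) g = dot f (T t g).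
Proof.
move=> t0; have h1 := dot_cvgl (g := g) (form_semigroup_cvg f t0).
have h2 := dot_cvgr (g := f) (form_semigroup_cvg g t0).
apply: cvg_unique h1 _ => //; apply: cvg_trans h2.
apply: near_eq_cvg; apply: nearW => n; exact/esym/iter_resolvent_sym.
Qed.

Lemma form_semigroup0 f : T 0 f = f.
Proof.
have := form_semigroup_cvg f (lexx 0) => /cvg_unique; apply => //.
have -> : (fun n => post_widder 0 n f) = fun=> f; last exact: cvg_cst.
apply/funext => n; rewrite /post_widder mul0r; move: n.+1 => m.
by elim: m => //= m ->; rewrite /J ltxx.
Qed.

Lemma form_semigroup_est1 t f g : 0 <= t -> gen f g ->
  `|T t f - f| <= t * `|g|.
Proof.
move=> t0 fg; apply: (norm_lim_le (form_semigroup_cvg f t0)) => n.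
have tn0 : 0 <= t / n.+1%:R by rewrite divr_ge0.
have := iter_resolvent_est1 n.+1 tn0 fg.
by have -> : n.+1%:R * (t / n.+1%:R) = t by rewrite mulrC divfK// pnatr_eq0.
Qed.

Lemma form_semigroup_est2 t f g k : 0 <= t -> gen f g -> gen g k ->
  `|T t f - f - t *: g| <= t ^+ 2 * `|k|.
Proof.
move=> t0 fg gk; rewrite -addrA -opprD.
apply: (norm_lim_le (form_semigroup_cvg f t0)) => n.
have tn0 : 0 <= t / n.+1%:R by rewrite divr_ge0.
have := iter_resolvent_est2 n.+1 tn0 fg gk.
have -> : n.+1%:R * (t / n.+1%:R) = t by rewrite mulrC divfK// pnatr_eq0.
by rewrite opprD addrA.
Qed.

(** By density it suffices to take [f] in the domain of [A^2]. There the approximants of the two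
    sides differ by [n + 1] local errors of order [1/(n+1)^2]. *)
Lemma form_semigroup_add s t f : 0 <= s -> 0 <= t -> T (s + t) f = T s (T t f).
Proof.
move=> s0 t0; have st0 : 0 <= s + t by rewrite addr_ge0.
apply: (ct_eq_dense (form_semigroup_ct st0)
  (ct_comp (form_semigroup_ct s0) (form_semigroup_ct t0)) gen2_dense) => {f}.
move=> f [g [k [fg gk]]] /=.
have h1 : (fun n => post_widder s n (post_widder t n f)) @ \oo --> T s (T t f).
  have h2 := form_semigroup_cvg (T t f) s0.
  apply/cvgrPdist_lt => e e0; have e20 : 0 < e / 2 by rewrite divr_gt0.
  move/cvgrPdist_lt : h2 => /(_ _ e20) h2.
  move/cvgrPdist_lt : (form_semigroup_cvg f t0) => /(_ _ e20) h3.
  near=> n.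
  have a1 : `|T s (T t f) - post_widder s n (T t f)| < e / 2 by near: n.
  have a2 : `|T t f - post_widder t n f| < e / 2 by near: n.
  have := ct_le (post_widder_ct s n) (T t f - post_widder t n f).
  rewrite (ctB _ _ (post_widder_ct s n)).
  have := ler_distD (post_widder s n (T t f)) (T s (T t f))
    (post_widder s n (post_widder t n f)).
  lra.
apply/eqP; rewrite -subr_eq0 -normr_le0; apply/ler_addgt0Pl => e e0; rewrite addr0.
have : (fun n => `|post_widder (s + t) n f - post_widder s n (post_widder t n f)|)
    @ \oo --> `|T (s + t) f - T s (T t f)|.
  by apply: cvg_norm; apply: cvgB => //; exact: form_semigroup_cvg.
move=> /cvgr_to_le; apply.
have C0 : 0 < 2 * (s + t) ^+ 2 * `|k| + 1 by rewrite ltr_wpDl// !mulr_ge0// exprn_ge0.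
have [N HN] := harmonic_small (divr_gt0 e0 C0).
exists N => // n /= /HN; rewrite ltr_pdivlMr// => Hn.
have sn0 : 0 <= s / n.+1%:R by rewrite divr_ge0.
have tn0 : 0 <= t / n.+1%:R by rewrite divr_ge0.
have stn0 : 0 <= (s + t) / n.+1%:R by rewrite divr_ge0.
(* Resolvents commute, so the product of two iterates is the iterate of one composite step. *)
have -> : post_widder s n (post_widder t n f) =
    iter n.+1 (J (s / n.+1%:R) \o J (t / n.+1%:R)) f.
  rewrite /post_widder; move: n.+1 (_ / _) (_ / _) sn0 tn0 => {Hn stn0} m a b a0 b0.
  elim: m => // m IH; rewrite [RHS]iterS -IH !iterS /=.
  by rewrite iter_comm// => x; exact: resolvent_comm.
apply: le_trans (iter_telescope _ _ (resolvent_ct _)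
  (ct_comp (resolvent_ct _) (resolvent_ct _)) _) _.
  move=> x /=; rewrite resolvent_comm//; congr (J _ _); exact: resolvent_comm.
have := resolvent_comp_est sn0 tn0 fg gk; rewrite -mulrDl /= => H1.
have := iter_resolvent_est2 1 stn0 fg gk; rewrite mul1r /= => H2.
set a := (s + t) / n.+1%:R in H1 H2 *.
set x := J a f; set y := J _ (J _ f).
rewrite -/x -/y in H1 H2.
have := ler_normB (x - f - a *: g) (y - f - a *: g).
have -> : x - f - a *: g - (y - f - a *: g) = x - y by vring.
move=> H3.
have H : `|x - y| <= 2 * a ^+ 2 * `|k| by lra.
apply: le_trans (ler_wpM2l _ H) _ => //.
have -> : n.+1%:R * (2 * a ^+ 2 * `|k|) = n.+1%:R^-1 * (2 * (s + t) ^+ 2 * `|k|).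
  by rewrite /a; field; rewrite addrC natr1 pnatr_eq0.
apply: le_trans (ltW Hn); rewrite ler_wpM2l ?invr_ge0// lerDl; exact: ler01.
Unshelve. all: by end_near. Qed.

Lemma form_semigroup_cont f : (fun t => `|T t f - f|) @ 0^'+ --> (0 : R).
Proof.
apply/cvgrPdist_lt => e e0; have e30 : 0 < e / 3 by rewrite divr_gt0.
have [u [g ug] fu] := gen_dense f e30.
have g0 : 0 < `|g| + 1 by rewrite ltr_wpDl.
near=> t.
have t0 : 0 < t by [].
have te : t < e / 3 / (`|g| + 1) by near: t; apply: nbhs_right_lt; rewrite divr_gt0.
rewrite sub0r normrN normr_id.
have := form_semigroup_est1 (ltW t0) ug.
have cT := form_semigroup_ct (ltW t0).
have := ct_le cT (f - u); rewrite (ctB _ _ cT).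
have := ler_normD (T t f - T t u) (T t u - f).
have := ler_normD (T t u - u) (u - f); rewrite !subrKA (distrC u f).
by move: te; rewrite ltr_pdivlMr//; lra.
Unshelve. all: by end_near. Qed.

(** On the domain of [A^2] this is the second-order estimate. In general [f = J 1 (f - g)] is
    approximated in graph norm by [v = J 1 w], with [w] in the domain of [A]; the first-order
    estimate applied to [f - v] has a bound proportional to [t], which survives division by [t]. *)
Lemma form_semigroup_gen f g : gen f g ->
  (fun t => `|t^-1 *: (T t f - f) - g|) @ 0^'+ --> (0 : R).
Proof.
move=> fg; apply/cvgrPdist_lt => e e0; have e80 : 0 < e / 8 by rewrite divr_gt0.
have [w [w' ww'] H] := gen_dense (f - g) e80.
have := resolvent_gen ler01 fg; rewrite scale1r => fE.
have Jw := gen_resolvent2 ler01 ww'.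
have Jw2 := gen_resolvent w' ltr01.
set k := _ *: _ in Jw2.
have k0 : 0 < `|k| + 1 by rewrite ltr_wpDl.
have d := gen_lin (-1) Jw fg; rewrite !scaleN1r in d.
near=> t.
have t0 : 0 < t by [].
have te : t < e / 4 / (`|k| + 1).
  by near: t; apply: nbhs_right_lt; rewrite divr_gt0// divr_gt0.
rewrite sub0r normrN normr_id.
have cT := form_semigroup_ct (ltW t0).
have := form_semigroup_est1 (ltW t0) d; have := form_semigroup_est2 (ltW t0) Jw Jw2.
set v := J 1 w; set v' := J 1 w'.
have vv : v' = v - w by have := resolvent_genE ler01 ww'; rewrite scale1r.
have gg : g = f - (f - g) by rewrite opprB addrC subrK.
have n1 : `|- v + f| <= e / 8.
  rewrite addrC -{1}fE -(ctB _ _ (resolvent_ct 1)).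
  exact: le_trans (ct_le (resolvent_ct 1) _) (ltW H).
have n2 : `|- v' + g| <= e / 4.
  have -> : - v' + g = (- v + f) - (f - g - w) by rewrite vv; vring.
  by apply: le_trans (ler_normB _ _) _; lra.
move=> H2 H1.
rewrite -[`|_|](mulKf (lt0r_neq0 t0)) mulrC -{1}(ger0_norm (ltW t0)) -normrZ.
rewrite ltr_pdivrMr// scalerBr scalerA divff ?gt_eqF// scale1r.
have -> : T t f - f - t *: g = (T t (- v + f) - (- v + f)) - t *: (- v' + g)
    + (T t v - v - t *: v').
  by rewrite (ctD _ _ cT) -[- v]scaleN1r (ctZ _ _ cT); vring.
apply: le_lt_trans (ler_normD _ _) _.
have := ler_normB (T t (- v + f) - (- v + f)) (t *: (- v' + g)).
rewrite normrZ (ger0_norm (ltW t0)).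
move: te; rewrite ltr_pdivlMr// => te.
have := ler_wpM2l (ltW t0) n2; have : t * (t * (`|k| + 1)) < t * (e / 4) by rewrite ltr_pM2l.
have : 0 <= t * t by apply: mulr_ge0; exact: ltW.
have := mulr_gt0 t0 e0.
lra.
Unshelve. all: by end_near. Qed.

Lemma sg_gen_dot (T' : R -> V -> V) f g x :
  (fun t => `|t^-1 *: (T' t f - f) - g|) @ 0^'+ --> (0 : R) ->
  (fun t => t^-1 * dot (T' t f - f) x) @ 0^'+ --> dot g x.
Proof.
move=> F0; apply/cvgrPdist_le => e e0.
have x0 : 0 < `|x| + 1 by rewrite ltr_wpDl.
move/cvgr0Pnorm_lt : F0 => /(_ _ (divr_gt0 e0 x0)); apply: filterS => t.
rewrite normr_id ltr_pdivlMr// => H.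
rewrite -dotZl distrC -dotBl; apply: le_trans (dot_CS _ _) _.
by apply: le_trans (ltW H); rewrite ler_wpM2l// lerDl.
Qed.

Arguments sg_gen_dot {T' f g} x.

(** A self-adjoint operator has no proper symmetric extension. Symmetry of [T'] passes to
    derivatives ([key]); taken at the vectors [J 1 w], it forces [f = J 1 (f - g)]. *)
Lemma gen_of_sym_deriv (T' : R -> V -> V) f g :
  (forall t x y, 0 <= t -> dot (T' t x) y = dot x (T' t y)) ->
  (forall x y, gen x y -> (fun t => `|t^-1 *: (T' t x - x) - y|) @ 0^'+ --> (0 : R)) ->
  (fun t => `|t^-1 *: (T' t f - f) - g|) @ 0^'+ --> (0 : R) -> gen f g.
Proof.
move=> Tsym Tgen fg.
have key u v : gen u v -> dot f v = dot g u.
  move=> uv; rewrite (ip_sym ip f).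
  have h1 := sg_gen_dot f (Tgen _ _ uv); apply: (cvg_unique _ h1) => //.
  apply: cvg_trans (sg_gen_dot u fg); apply: near_eq_cvg; near=> t.
  have t0 : 0 < t by [].
  by rewrite !dotBl Tsym ?ltW// (ip_sym ip f) (ip_sym ip f u).
have fE : f = J 1 (f - g).
  apply: dot_ext => w; rewrite resolvent_sym dotBl.
  have := gen_resolvent w ltr01; rewrite invr1 scale1r => /key.
  by rewrite dotBr => <-; rewrite opprB addrC subrK.
have := gen_resolvent (f - g) ltr01; rewrite -fE invr1 scale1r.
by rewrite opprB addrC subrK.
Unshelve. all: by end_near. Qed.

End resolvent.

Record sym_semigroup (T : R -> V -> V) : Prop := SymSemigroup {
  ss_ct : forall t, 0 <= t -> contraction (T t);
  ss_sym : forall t f g, 0 <= t -> dot (T t f) g = dot f (T t g);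
  ss_0 : forall f, T 0 f = f;
  ss_add : forall s t f, 0 <= s -> 0 <= t -> T (s + t) f = T s (T t f);
  ss_cont : forall f, (fun t => `|T t f - f|) @ 0^'+ --> (0 : R) }.

Definition sg_gen (T : R -> V -> V) (f g : V) : Prop :=
  (fun t => `|t^-1 *: (T t f - f) - g|) @ 0^'+ --> (0 : R).

Lemma form_semigroupP Dom E : closed_form dot Dom E ->
  exists T, sym_semigroup T /\ forall f g, sg_gen T f g <-> form_gen dot Dom E f g.
Proof.
move=> cf; exists (form_semigroup Dom E); split.
  split.
  - move=> t; exact: form_semigroup_ct.
  - move=> t f g; exact: form_semigroup_sym.
  - exact: form_semigroup0.
  - move=> s t f; exact: form_semigroup_add.
  - exact: form_semigroup_cont.
move=> f g; split; last exact: form_semigroup_gen.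
apply: (gen_of_sym_deriv cf) => [t x y|x y]; first exact: form_semigroup_sym.
exact: form_semigroup_gen.
Qed.

Lemma cvg_le (T : Type) (F : set_system T) {FF : ProperFilter F}
    (f g : T -> R) (a b : R) : f @ F --> a -> g @ F --> b ->
  (\forall x \near F, f x <= g x) -> a <= b.
Proof.
move=> fa gb fg; rewrite -subr_ge0.
have /cvgr_to_ge : (fun x => g x - f x) @ F --> b - a by exact: cvgB.
by apply; apply: filterS fg => x; rewrite subr_ge0.
Qed.

(** * Recovering a closed form from its semigroup *)

Section form_of_semigroup.
Context (Dom : set V) (E : V -> V -> R) (T : R -> V -> V).
Hypothesis cf : closed_form dot Dom E.
Hypothesis sT : sym_semigroup T.
Local Notation gen := (form_gen dot Dom E).
Local Notation J := (resolvent Dom E).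
Hypothesis genT : forall f g, gen f g -> sg_gen T f g.
Let hE := cf_si cf.

(** Up to the factor [1/t], the form approximating [E]. It is defined on the whole space, so
    Cauchy-Schwarz is available for an [f] not yet known to be in [Dom]. *)
Lemma sg_si t : 0 <= t -> semi_inner [set: V] (fun f g => dot (f - T t f) g).
Proof.
move=> t0; have cT := ss_ct sT t0; split=> //.
- by move=> f g _ _; rewrite !dotBl (ss_sym sT)// (ip_sym ip f g) (ip_sym ip f).
- by move=> c f g h _ _ _; rewrite (ct_lin cT) -dotZl -dotDl; congr dot; vring.
- move=> f _; rewrite dotBl (ip_norm ip) subr_ge0.
  apply: le_trans (ler_norm _) _; apply: le_trans (dot_CS _ _) _.
  by rewrite expr2 ler_wpM2r// (ct_le cT).
Qed.

Lemma gen_seq f : Dom f -> exists u v : nat -> V,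
  [/\ forall n, gen (u n) (v n), u @ \oo --> f &
   (fun n => E (u n - f) (u n - f)) @ \oo --> (0 : R)].
Proof.
move=> Df.
have H n : exists p, gen p.1 p.2 /\
    dot (f - p.1) (f - p.1) + E (f - p.1) (f - p.1) < n.+1%:R^-1.
  have n0 : 0 < n.+1%:R^-1 :> R by rewrite invr_gt0.
  by have [u [v uv]] := gen_form_dense cf Df n0; exists (u, v).
have [p pP] := choice H; exists (fst \o p), (snd \o p) => /=.
have D n : Dom (f - (p n).1) by apply: (si_B hE) => //; have [[]] := pP n.
have E0 n : E ((p n).1 - f) ((p n).1 - f) = E (f - (p n).1) (f - (p n).1).
  by apply: (si_sqC hE) => //; have [[]] := pP n.
split=> [n||]; first by have [] := pP n.
- apply/cvgrPdist_lt => e e0; have [N HN] := harmonic_small (exprn_gt0 2 e0).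
  exists N => // n /= /HN h; rewrite -[`|_|]normr_id.
  apply: normr_lt_sqr; first exact: ltW.
  rewrite -(ip_norm ip); apply: lt_trans h; have [_] := pP n.
  by apply: le_lt_trans; rewrite lerDl (si_ge0 hE).
- apply/cvgr0Pnorm_lt => e e0; have [N HN] := harmonic_small e0.
  exists N => // n /= /HN h; rewrite E0 ger0_norm ?(si_ge0 hE)//.
  apply: lt_trans h; have [_] := pP n; apply: le_lt_trans.
  by rewrite lerDr (ip_norm ip) sqr_ge0.
Qed.

Lemma sg_gen_form f g h : gen f g ->
  (fun t => t^-1 * dot (f - T t f) h) @ 0^'+ --> - dot g h.
Proof.
move=> /genT fg; have -> : (fun t => t^-1 * dot (f - T t f) h) =
    (fun t => - (t^-1 * dot (T t f - f) h)).
  by apply/funext => t; rewrite -mulrN -dotNl opprB.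
by apply: cvgN; exact: sg_gen_dot.
Qed.

Arguments sg_gen_form {f g} h.

(** Cauchy-Schwarz for the approximating forms, in the limit [t -> 0]. *)
Lemma sg_form_bound f (C : R) g v :
  (fun t => t^-1 * dot (f - T t f) f) @ 0^'+ --> C -> gen g v ->
  dot v f ^+ 2 <= C * E g g.
Proof.
move=> fC gv; have [Dg /(_ _ Dg) ->] := gv; rewrite -sqrrN.
have h1 := sg_gen_form f gv; have h2 := sg_gen_form g gv.
have h3 : (fun t => (t^-1 * dot (g - T t g) f) * (t^-1 * dot (g - T t g) f))
    @ 0^'+ --> - dot v f * - dot v f by exact: cvgM.
have h4 : (fun t => (t^-1 * dot (f - T t f) f) * (t^-1 * dot (g - T t g) g))
    @ 0^'+ --> C * - dot v g by exact: cvgM.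
rewrite expr2; apply: cvg_le h3 h4 _; near=> t.
have t0 : 0 < t by [].
have := si_CS (sg_si (ltW t0)) (I : setT g) (I : setT f) => H.
have := ler_wpM2l (sqr_ge0 t^-1) H; move: t^-1 => i.
by move: (dot (g - T t g) f) (dot (g - T t g) g) (dot (f - T t f) f) => x y z; lra.
Unshelve. all: by end_near. Qed.

(** The functional [g |-> <g - A g, f>] on the domain of [A] is bounded for [dot + E], by
    [(x - y)^2 <= 2 x^2 + 2 y^2] and the previous bound. Its representative [u] in [Dom] satisfies
    [<w, u> = <w, f>] for all [w], as the vectors [J 1 w] show. *)
Lemma sg_form_dom f (C : R) :
  (fun t => t^-1 * dot (f - T t f) f) @ 0^'+ --> C -> Dom f.
Proof.
move=> fC; pose S := [set u | exists v, gen u v].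
have C0 : 0 <= C.
  apply: cvg_le (cvg_cst 0) fC _; near=> t.
  have t0 : 0 < t by [].
  apply: mulr_ge0; first by rewrite invr_ge0 ltW.
  exact: (si_ge0 (sg_si (ltW t0)) (I : setT f)).
(* The generator is only a graph; the limit stands for [- <A g, f>] and makes [l] a total
   function. *)
pose l g := dot g f + lim ((fun t => t^-1 * dot (g - T t g) f) @ 0^'+).
have lE g v : gen g v -> l g = dot (g - v) f.
  by move=> gv; rewrite /l (cvg_lim _ (sg_gen_form f gv))// dotBl.
have E1 := E1_si cf.
have [||||||u [Du uP _]] := @riesz _ _ Dom S _ l (2 * `|f| ^+ 2 + 2 * C)
  E1 (cf_complete cf).
- by rewrite addr_ge0 ?mulr_ge0 ?sqr_ge0.
- by move=> g [v []].
- by exists 0; split=> [|k Dk]; [exact: (si_zero hE)|rewrite (si0l hE)// (si0l ip_si)// oppr0].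
- by move=> c g g' [v gv] [v' gv']; exists (c *: v + v'); exact: gen_lin.
- move=> c g g' [v gv] [v' gv'].
  rewrite (lE _ _ (gen_lin cf c gv gv')) (lE _ _ gv) (lE _ _ gv').
  by rewrite !(dotBl, dotDl, dotZl); ring.
- move=> g [v gv]; rewrite (lE _ _ gv) dotBl.
  have b1 := sg_form_bound fC gv.
  have := si_CS ip_si (I : setT g) (I : setT f); rewrite !(ip_norm ip) => b2.
  have Dg : Dom g by case: gv.
  have := si_ge0 hE Dg; have f0 : 0 <= `|f| ^+ 2 by exact: sqr_ge0.
  have g0 : 0 <= `|g| ^+ 2 by exact: sqr_ge0.
  have := sqr_ge0 (dot g f + dot v f).
  move: (`|f| ^+ 2) (`|g| ^+ 2) (dot g f) (dot v f) (E g g) b1 b2 f0 g0.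
  move=> F G x y e b1 b2 F0 G0 h1 h2.
  have : 0 <= F * e by exact: mulr_ge0.
  have : 0 <= C * G by exact: mulr_ge0.
  lra.
suff -> : f = u by [].
apply: dot_ext => w; have gw := gen_resolvent cf w ltr01.
have := uP (J 1 w) (ex_intro _ _ gw); rewrite (lE _ _ gw).
have [DJ gwP] := gw.
rewrite (ip_sym ip u) (si_sym hE Du DJ) -[E _ _]mul1r (resolventE cf)//.
rewrite (ip_sym ip w) => ->.
by rewrite invr1 scale1r opprB addrC subrK (ip_sym ip).
Unshelve. all: by end_near. Qed.

Lemma sg_form_le f t : 0 < t -> Dom f -> dot (f - T t f) f <= t * E f f.
Proof.
move=> t0 Df.
suff H g v : gen g v -> dot (g - T t g) g <= t * E g g.
  have [u [v [uv uf Euf]]] := gen_seq Df.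
  have Du n : Dom (u n) by case: (uv n).
  have h1 := si_cvg_sq hE Du Df Euf.
  have h2 : (fun n => t * E (u n) (u n)) @ \oo --> t * E f f by exact: cvgMl_tmp.
  apply: cvg_le h2 _; last by apply: nearW => n; exact: H (uv n).
  apply: dot_cvg => //; apply: cvgB => //.
  exact: ct_cvg (ss_ct sT (ltW t0)) uf.
move=> gv.
(* [s |-> <g - T_s g, g>] is concave and vanishes at [0]. *)
have conc s n : 0 <= s -> dot (g - T (n%:R * s) g) g <= n%:R * dot (g - T s g) g.
  move=> s0; have cT r : 0 <= r -> contraction (T r) by exact: (ss_ct sT).
  have ns m : 0 <= m%:R * s by rewrite mulr_ge0.
  pose d m := dot (T (m%:R * s) (g - T s g)) g.
  have TC a b x : 0 <= a -> 0 <= b -> T a (T b x) = T b (T a x).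
    by move=> a0 b0; rewrite -!(ss_add sT)// addrC.
  (* With [w = g - T s g] and [m s = 2 h], the decrease is [<T_(2h) w, w> = |T_h w|^2]. *)
  have dS m : d m.+1 <= d m.
    pose h := m%:R * s / 2; have h0 : 0 <= h by rewrite divr_ge0.
    have hh : m%:R * s = h + h by rewrite /h; field.
    pose w := g - T s g.
    have e2 : d m = dot (T h (T h w)) g by rewrite /d hh (ss_add sT).
    have e1 : d m.+1 = dot (T h (T h w)) (T s g).
      rewrite /d -natr1 mulrDl mul1r addrC (ss_add sT)// hh (ss_add sT)//.
      by rewrite (ss_sym sT).
    have e3 : dot (T h (T h w)) w = `|T h w| ^+ 2.
      by rewrite (ss_sym sT)// (ip_norm ip).
    have : 0 <= dot (T h (T h w)) w by rewrite e3 sqr_ge0.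
    by rewrite e1 e2 {2}/w dotBr subr_ge0.
  have d0 m : d m <= d 0%N by elim: m => // m IH; exact: le_trans (dS m) IH.
  elim: n => [|n IH]; first by rewrite !mul0r (ss_0 sT) subrr (si0l ip_si).
  have -> : dot (g - T (n.+1%:R * s) g) g = dot (g - T (n%:R * s) g) g + d n.
    rewrite /d (ctB _ _ (cT _ (ns n))) -(ss_add sT)// -dotDl subrKA.
    by rewrite -natr1 mulrDl mul1r.
  rewrite -natr1 mulrDl mul1r lerD//; apply: le_trans (d0 n) _.
  by rewrite /d mul0r (ss_0 sT).
have := sg_gen_form g gv; have [Dg /(_ _ Dg) <-] := gv => h1.
apply/ler_addgt0Pl => e e0.
(* [conc] is used with [s = t / (N + 1)] so small that the difference quotient at [s] is within
   [e / t] of [E g g]. *)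
have et0 : 0 < e / t by rewrite divr_gt0.
move/cvgrPdist_lt : h1 => /(_ _ et0) h1.
case: h1 => d d0 h1.
have [N /(_ N (leqnn N)) HN] := harmonic_small (divr_gt0 d0 t0).
have {h1} := h1 (t / N.+1%:R).
have tN0 : 0 < t / N.+1%:R by rewrite divr_gt0.
rewrite /= sub0r normrN (gtr0_norm tN0) => /(_ _ tN0).
have -> : t / N.+1%:R < d by move: HN; rewrite ltr_pdivlMr// mulrC.
move=> /(_ isT).
have N0 : N.+1%:R != 0 :> R by rewrite pnatr_eq0.
have tN : 0 <= t / N.+1%:R by rewrite divr_ge0// ltW.
have := conc (t / N.+1%:R) N.+1 tN.
have -> : N.+1%:R * (t / N.+1%:R) = t by rewrite mulrC divfK.
set x := dot (g - T (t / _) g) g => H1.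
rewrite ltr_distlC => /andP[_].
have -> : (t / N.+1%:R)^-1 * x = N.+1%:R * x / t by rewrite invf_div; field; rewrite gt_eqF.
rewrite ltr_pdivrMr// mulrDl divfK ?gt_eqF// (mulrC _ t) => H2.
by apply: le_trans H1 _; rewrite addrC ltW.
Qed.

(** Applied to generator vectors tending to [f] in form norm, [sg_form_bound] gives
    [(E f f)^2 <= C E f f] in the limit; the converse inequality is [sg_form_le] divided by [t]. *)
Lemma sg_form_val f (C : R) :
  (fun t => t^-1 * dot (f - T t f) f) @ 0^'+ --> C -> E f f = C.
Proof.
move=> fC; have Df := sg_form_dom fC; apply/le_anti/andP; split; last first.
  apply: cvg_le fC (cvg_cst (E f f)) _; near=> t.
  have t0 : 0 < t by [].
  by rewrite ler_pdivrMl//; exact: sg_form_le.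
have [u [v [uv uf Euf]]] := gen_seq Df.
have Du n : Dom (u n) by case: (uv n).
have h1 := si_cvg_sq hE Du Df Euf.
have h2 := si_cvg_l hE Du Df Df Euf.
have h3 : (fun n => E (u n) f * E (u n) f) @ \oo --> E f f * E f f by exact: cvgM.
have h4 : (fun n => C * E (u n) (u n)) @ \oo --> C * E f f by exact: cvgMl_tmp.
have : E f f * E f f <= C * E f f.
  apply: cvg_le h3 h4 _; apply: nearW => n.
  have := sg_form_bound fC (uv n); have [_ /(_ _ Df)] := uv n.
  by move=> ->; rewrite mulrNN -expr2.
have C0 : 0 <= C.
  apply: cvg_le (cvg_cst 0) fC _; near=> t.
  have t0 : 0 < t by [].
  apply: mulr_ge0; first by rewrite invr_ge0 ltW.
  exact: (si_ge0 (sg_si (ltW t0)) (I : setT f)).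
have [->//|E0] := eqVneq (E f f) 0.
by rewrite ler_pM2r// lt0r E0 (si_ge0 hE).
Unshelve. all: by end_near. Qed.

End form_of_semigroup.

(** * Approximating forms built from the resolvent *)

Section resolvent_form.
Context (Dom : set V) (E : V -> V -> R).
Hypothesis cf : closed_form dot Dom E.
Local Notation gen := (form_gen dot Dom E).
Local Notation J := (resolvent Dom E).
Let hE := cf_si cf.

Lemma resolvent_form f g h : 0 < h -> Dom g ->
  h^-1 * dot (f - J h f) g = E (J h f) g.
Proof.
move=> h0 Dg; rewrite dotBl -(resolventE cf f h0 Dg) addrAC subrr add0r.
by rewrite mulKf// gt_eqF.
Qed.

(** The identity [h E (J f) (f - J f) = |f - J f|^2] gives [E (J f) (J f) <= E (J f) f]; positivity
    of [E] at [f - J f] does the rest. *)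
Lemma resolvent_form_le f h : 0 < h -> Dom f ->
  E (J h f) (J h f) <= E f f /\ E (J h f) f <= E f f.
Proof.
move=> h0 Df; have DJ := resolvent_dom cf f h0.
have Dd := si_B hE Df DJ.
have : 0 <= h * E (J h f) (f - J h f).
  have -> : h * E (J h f) (f - J h f) = dot (f - J h f) (f - J h f).
    by rewrite [RHS]dotBl -(resolventE cf f h0 Dd) addrAC subrr add0r.
  by rewrite (ip_norm ip) sqr_ge0.
rewrite pmulr_rge0// (siBr hE)// subr_ge0 => H.
have := si_ge0 hE Dd; rewrite (si_sqB hE)// (si_sym hE Df DJ).
by move: H; split; lra.
Qed.

Lemma resolvent_form_dot_le f h : 0 < h -> Dom f ->
  h^-1 * dot (f - J h f) f <= E f f.
Proof. by move=> h0 Df; rewrite resolvent_form//; case: (resolvent_form_le h0 Df). Qed.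

Lemma resolvent_cvg f : (fun h => `|J h f - f|) @ 0^'+ --> (0 : R).
Proof.
apply/cvgrPdist_lt => e e0; have e30 : 0 < e / 3 by rewrite divr_gt0.
have [u [g ug] fu] := gen_dense cf f e30.
have g0 : 0 < `|g| + 1 by rewrite ltr_wpDl.
near=> t.
have t0 : 0 < t by [].
have te : t < e / 3 / (`|g| + 1) by near: t; apply: nbhs_right_lt; rewrite divr_gt0.
rewrite sub0r normrN normr_id.
have cJ := resolvent_ct cf t.
have := resolvent_est1 cf (ltW t0) ug.
have := ct_le cJ (f - u); rewrite (ctB _ _ cJ).
have := ler_normD (J t f - J t u) (J t u - f).
have := ler_normD (J t u - u) (u - f); rewrite !subrKA (distrC u f).
by move: te; rewrite ltr_pdivlMr//; lra.
Unshelve. all: by end_near. Qed.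

(** Weak convergence of [J h f] to [f] for [E]: against a vector [u] of the generator domain, [E]
    becomes an inner product, which tends to 0; the remainder [g - u] is controlled because the
    energies of [f - J h f] stay bounded. *)
Lemma resolvent_form_cvg f g : Dom f -> Dom g ->
  (fun h => h^-1 * dot (f - J h f) g) @ 0^'+ --> E f g.
Proof.
move=> Df Dg; apply/cvgrPdist_lt => e e0.
have Ef0 := si_ge0 hE Df.
(* Chosen so that [4 E f f] times [d] is at most [(e / 2)^2]; [4 E f f] bounds the energy of
   [f - J h f]. *)
pose d := (e / 2) ^+ 2 / (4 * E f f + 1).
have c0 : 0 < 4 * E f f + 1 by lra.
have d0 : 0 < d by rewrite divr_gt0// exprn_gt0// divr_gt0.
have [u [v [uv H]]] := gen_form_dense cf Dg d0.
have v0 : 0 < `|v| + 1 by rewrite ltr_wpDl.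
have e2v : 0 < e / 2 / (`|v| + 1) by rewrite divr_gt0// divr_gt0.
have /cvgrPdist_lt/(_ _ e2v) Jf := resolvent_cvg f.
near=> h.
have h0 : 0 < h by [].
have : `| 0 - `|J h f - f| | < e / 2 / (`|v| + 1) by near: h.
rewrite sub0r normrN normr_id ltr_pdivlMr// => nv.
rewrite resolvent_form//.
have DJ := resolvent_dom cf f h0; have Dd := si_B hE Df DJ.
have Du : Dom u by case: uv.
have Dgu := si_B hE Dg Du.
rewrite -(siBl hE)//.
have -> : E (f - J h f) g = E (f - J h f) u + E (f - J h f) (g - u).
  by rewrite (siBr hE Dg Du Dd); ring.
apply: le_lt_trans (ler_normD _ _) _.
have a1 : `|E (f - J h f) u| < e / 2.
  rewrite (si_sym hE)//; have [_ ->//] := uv; rewrite normrN.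
  apply: le_lt_trans (dot_CS _ _) _; rewrite distrC mulrC.
  by apply: le_lt_trans nv; rewrite ler_wpM2l// lerDl.
have a2 : `|E (f - J h f) (g - u)| <= e / 2.
  apply: normr_le_sqr; first by rewrite ltW// divr_gt0.
  apply: le_trans (si_CS hE Dd Dgu) _.
  have b1 : E (f - J h f) (f - J h f) <= 4 * E f f.
    have [+ _] := resolvent_form_le h0 Df.
    have := si_sqB_le hE Df (si_zero hE) DJ.
    rewrite subr0 sub0r -[- J h f]scaleN1r (si_sqZ hE)// sqrrN expr1n mul1r; lra.
  have b2 : E (g - u) (g - u) <= d.
    by apply: ltW; apply: le_lt_trans H; rewrite lerDr (ip_norm ip) sqr_ge0.
  apply: le_trans (ler_pM (si_ge0 hE Dd) (si_ge0 hE Dgu) b1 b2) _.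
  rewrite /d mulrA ler_pdivrMr// mulrC ler_wpM2l ?sqr_ge0//; lra.
lra.
Unshelve. all: by end_near. Qed.

End resolvent_form.
End hilbert.

(** * The weighted sequence space L^2(mu) *)

Section nonneg_series.
Context (R : realType).
Implicit Types u : nat -> R.

Lemma nneseries_lty_bound u : (forall i, 0 <= u i) ->
  (\sum_(0 <= i <oo) (u i)%:E < +oo)%E ->
  exists M, forall n, \sum_(0 <= i < n) u i <= M.
Proof.
move=> u0 uoo; have := nnseries_is_cvg u0 uoo => /cvg_seq_bounded.
move=> /bounded_fun_has_ubound[M uM].
by exists M => n; apply: uM; exists n.
Qed.

Lemma bound_nneseries_lty u (M : R) : (forall i, 0 <= u i) ->
  (forall n, \sum_(0 <= i < n) u i <= M) ->
  (\sum_(0 <= i <oo) (u i)%:E < +oo)%E.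
Proof.
move=> u0 uM; apply: (@le_lt_trans _ _ M%:E); last exact: ltry.
apply: lime_le; first by apply: is_cvg_nneseries => n _ _; rewrite lee_fin.
by apply: nearW => n; rewrite sumEFin lee_fin.
Qed.

Lemma nneseries_ge_bound u n : (forall i, 0 <= u i) -> cvgn (series u) ->
  \sum_(0 <= i < n) u i <= limn (series u).
Proof.
move=> u0 cu; apply: nondecreasing_cvgn_le => //.
exact: nondecreasing_series.
Qed.

Lemma lim_series_le_bound u (M : R) : cvgn (series u) ->
  (forall n, \sum_(0 <= i < n) u i <= M) -> limn (series u) <= M.
Proof. by move=> cu uM; apply: limr_le => //; apply: nearW => n; exact: uM. Qed.

Lemma sum_tail0 u n m : (forall i, (n <= i)%N -> u i = 0) -> (n <= m)%N ->
  \sum_(0 <= i < m) u i = \sum_(0 <= i < n) u i.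
Proof.
move=> u0 nm; rewrite (big_cat_nat (leq0n _) nm)//=.
rewrite [X in _ + X]big_nat_cond [X in _ + X]big1 ?addr0//.
by move=> i /andP[/andP[ni _] _]; exact: u0.
Qed.

Lemma cvg_sum_nat (T : Type) (F : set_system T) {FF : Filter F} n
    (f : nat -> T -> R) (a : nat -> R) : (forall i, f i @ F --> a i) ->
  (fun x => \sum_(0 <= i < n) f i x) @ F --> \sum_(0 <= i < n) a i.
Proof.
move=> fa; elim: n => [|n IH].
  by under eq_fun do rewrite big_nil; rewrite big_nil; exact: cvg_cst.
under eq_fun do rewrite big_nat_recr//=; rewrite big_nat_recr//=.
exact: cvgD.
Qed.

Lemma series_eventually0 u n : (forall i, (n <= i)%N -> u i = 0) ->
  series u @ \oo --> \sum_(0 <= i < n) u i.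
Proof.
move=> u0; apply: cvg_near_cst; exists n => // m /= nm.
exact: sum_tail0.
Qed.

End nonneg_series.

Section l2.
Context (R : realType) (mu : nat -> R) (mu0 : forall i, 0 < mu i).
Implicit Types f g : nat -> R.

Let term0 f i : 0 <= mu i * f i ^+ 2.
Proof. by rewrite mulr_ge0 ?sqr_ge0 ?ltW. Qed.

Lemma L2_bound f : L2 mu f ->
  exists M, forall n, \sum_(0 <= i < n) mu i * f i ^+ 2 <= M.
Proof. by move=> Lf; exact: nneseries_lty_bound. Qed.

Lemma bound_L2 f (M : R) : (forall n, \sum_(0 <= i < n) mu i * f i ^+ 2 <= M) ->
  L2 mu f.
Proof. by move=> fM; apply: bound_nneseries_lty fM. Qed.

Lemma L2_le f g : (forall i, `|f i| <= `|g i|) -> L2 mu g -> L2 mu f.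
Proof.
move=> fg /L2_bound[M gM]; apply: (@bound_L2 _ M) => n.
apply: le_trans (gM n); apply: ler_sum => i _.
by rewrite ler_wpM2l ?(ltW (mu0 i))// ler_norm_sqr.
Qed.

Lemma L2_lin c f g : L2 mu f -> L2 mu g -> L2 mu (c *: f + g).
Proof.
move=> /L2_bound[M fM] /L2_bound[N gN].
apply: (@bound_L2 _ (2 * c ^+ 2 * M + 2 * N)) => n.
have := fM n; have := gN n => h1 h2.
have c2 : 0 <= c ^+ 2 by exact: sqr_ge0.
apply: (@le_trans _ _ (2 * c ^+ 2 * \sum_(0 <= i < n) mu i * f i ^+ 2 +
   2 * \sum_(0 <= i < n) mu i * g i ^+ 2)).
  rewrite !mulr_sumr -big_split /=; apply: ler_sum => i _.
  have -> : (c *: f + g) i = c * f i + g i by [].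
  have := mulr_ge0 (ltW (mu0 i)) (sqr_ge0 (c * f i - g i)); lra.
by rewrite lerD// ler_wpM2l// mulr_ge0.
Qed.

Lemma L2_0 : L2 mu 0.
Proof.
apply: (@bound_L2 _ 0) => n; rewrite big1// => i _.
by rewrite [X in X ^+ 2](_ : _ = 0)// expr0n mulr0.
Qed.

Lemma L2dot_cvg f g : L2 mu f -> L2 mu g ->
  cvgn (series (fun i => mu i * f i * g i)).
Proof.
move=> Lf Lg; apply: normed_cvg.
apply: (@series_le_cvg _ _ (fun i => mu i * f i ^+ 2 + mu i * g i ^+ 2)).
- by move=> n /=.
- by move=> n; rewrite addr_ge0.
- move=> n /=; have m0 := ltW (mu0 n).
  have a := mulr_ge0 m0 (sqr_ge0 (f n - g n)).
  have b := mulr_ge0 m0 (sqr_ge0 (f n + g n)).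
  have c := mulr_ge0 m0 (sqr_ge0 (f n)).
  have d := mulr_ge0 m0 (sqr_ge0 (g n)).
  by rewrite ler_norml; lra.
- apply: is_cvg_seriesD; exact: nnseries_is_cvg.
Qed.

Lemma L2dot_sym f g : L2dot mu f g = L2dot mu g f.
Proof.
by rewrite /L2dot; congr (lim (series _ @ \oo)); apply/funext => i; ring.
Qed.

Lemma L2dot_lin c f g h : L2 mu f -> L2 mu g -> L2 mu h ->
  L2dot mu (c *: f + g) h = c * L2dot mu f h + L2dot mu g h.
Proof.
move=> Lf Lg Lh; apply: cvg_lim => //.
have -> : series (fun i => mu i * (c *: f + g) i * h i) =
   (fun n => c * series (fun i => mu i * f i * h i) n +
      series (fun i => mu i * g i * h i) n).
  apply/funext => n; rewrite /series /= mulr_sumr -big_split /=.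
  by apply: eq_bigr => i _; have -> : (c *: f + g) i = c * f i + g i by []; ring.
apply: cvgD; last exact: L2dot_cvg.
by apply: cvgMl_tmp; exact: L2dot_cvg.
Qed.

Lemma L2dotE f : L2dot mu f f = limn (series (fun i => mu i * f i ^+ 2)).
Proof. by rewrite /L2dot; congr (lim (series _ @ \oo)); apply/funext => i; ring. Qed.

Lemma L2_cvg f : L2 mu f -> cvgn (series (fun i => mu i * f i ^+ 2)).
Proof. by move=> Lf; exact: nnseries_is_cvg. Qed.

Lemma L2dot_ge f n : L2 mu f -> \sum_(0 <= i < n) mu i * f i ^+ 2 <= L2dot mu f f.
Proof. by move=> Lf; rewrite L2dotE; apply: nneseries_ge_bound => //; exact: L2_cvg. Qed.

Lemma L2dot_le f (M : R) : (forall n, \sum_(0 <= i < n) mu i * f i ^+ 2 <= M) ->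
  L2dot mu f f <= M.
Proof.
move=> fM; rewrite L2dotE; apply: lim_series_le_bound => //.
by apply: L2_cvg; exact: bound_L2 fM.
Qed.

Lemma L2dot_ge0 f : L2 mu f -> 0 <= L2dot mu f f.
Proof. by move=> Lf; have := L2dot_ge 0 Lf; rewrite big_nil. Qed.

Lemma L2dot_ge_term f i : L2 mu f -> mu i * f i ^+ 2 <= L2dot mu f f.
Proof.
move=> Lf; apply: le_trans (L2dot_ge i.+1 Lf).
by rewrite big_nat_recr//= lerDr sumr_ge0.
Qed.

Lemma L2_si : semi_inner (L2 mu) (L2dot mu).
Proof.
split.
- exact: L2_0.
- exact: L2_lin.
- by move=> f g _ _; exact: L2dot_sym.
- exact: L2dot_lin.
- exact: L2dot_ge0.
Qed.

Lemma L2dot_fin f g n : (forall i, (n <= i)%N -> f i = 0) ->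
  L2dot mu f g = \sum_(0 <= i < n) mu i * f i * g i.
Proof.
move=> f0; apply: cvg_lim => //; apply: series_eventually0 => i ni.
by rewrite f0// mulr0 mul0r.
Qed.

Lemma L2_fin f n : (forall i, (n <= i)%N -> f i = 0) -> L2 mu f.
Proof.
move=> f0; apply: (@bound_L2 _ (\sum_(0 <= i < n) mu i * f i ^+ 2)) => m.
have [mn|/ltnW nm] := leqP m n.
  by rewrite [leRHS](big_cat_nat (leq0n _) mn)//= lerDl sumr_ge0.
by rewrite (sum_tail0 _ nm)// => i ni; rewrite f0// expr0n mulr0.
Qed.

Definition trunc n f : nat -> R := fun i => if (i < n)%N then f i else 0.

Lemma trunc_small f e : L2 mu f -> 0 < e ->
  exists N, forall n, (N <= n)%N -> L2dot mu (f - trunc n f) (f - trunc n f) < e.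
Proof.
move=> Lf e0; have := L2_cvg Lf; rewrite /L2dot.
move=> /cvgrPdist_lt/(_ (e / 2) (divr_gt0 e0 (ltr0n _ 2)))[N _ HN].
exists N => n Nn; have := HN _ Nn; rewrite -L2dotE => H.
apply: (@le_lt_trans _ _ (e / 2)); last by lra.
apply: L2dot_le => m.
have tE i : (f - trunc n f) i = if (i < n)%N then 0 else f i.
  by rewrite -[LHS]/(f i - trunc n f i) /trunc; case: ifP; rewrite ?subrr ?subr0.
have [mn|/ltnW nm] := leqP m n.
  rewrite big_nat_cond big1 ?divr_ge0 ?(ltW e0)// => i /andP[/andP[_ im] _].
  by rewrite tE (leq_trans im mn) expr0n mulr0.
rewrite (big_cat_nat (leq0n _) nm)//= [X in X + _]big_nat_cond big1 ?add0r; last first.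
  by move=> i /andP[/andP[_ im] _]; rewrite tE im expr0n mulr0.
apply: le_trans (ltW H).
have := L2dot_ge m Lf; rewrite (big_cat_nat (leq0n _) nm)//=.
rewrite /series /=.
have -> : \sum_(n <= i < m) mu i * (f - trunc n f) i ^+ 2 = \sum_(n <= i < m) mu i * f i ^+ 2.
  by apply: eq_big_nat => i /andP[ni _]; rewrite tE ltnNge ni.
move: (\sum_(n <= i < m) _) (\sum_(0 <= i < n) _) (L2dot _ _ _) => x y z h.
by apply: le_trans (ler_norm _); lra.
Qed.

(** Coordinates are continuous because [mu i > 0], which supplies a pointwise limit; bounds on
    partial sums pass to that limit as in Fatou's lemma. *)
Lemma L2_complete : si_complete (L2 mu) (L2dot mu).
Proof.
move=> u Lu uc.
have Lmn m n : L2 mu (u m - u n) by exact: (si_B L2_si).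
have pc i : cvgn (fun n => u n i).
  apply: cauchy_seq_cvg => e e0.
  have [N HN] := uc _ (mulr_gt0 (mu0 i) (exprn_gt0 2 e0)).
  exists N => m n Nm Nn; apply: normr_lt_sqr; first exact: ltW.
  have := le_lt_trans (L2dot_ge_term i (Lmn m n)) (HN _ _ Nm Nn).
  by rewrite ltr_pM2l.
pose f i := limn (fun n => u n i).
have key e N k : (N <= k)%N -> (forall m n, (N <= m)%N -> (N <= n)%N ->
    L2dot mu (u m - u n) (u m - u n) < e) ->
    forall n, \sum_(0 <= i < n) mu i * (u k - f) i ^+ 2 <= e.
  move=> Nk H n.
  have : (fun m => \sum_(0 <= i < n) mu i * (u k - u m) i ^+ 2) @ \oo -->
      \sum_(0 <= i < n) mu i * (u k - f) i ^+ 2.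
    apply: cvg_sum_nat => i; apply: cvgMl_tmp.
    have c : (fun m => (u k - u m) i) @ \oo --> (u k - f) i.
      by apply: cvgB; [exact: cvg_cst|exact: pc].
    by rewrite expr2; under eq_fun do rewrite expr2; exact: cvgM.
  move=> /cvgr_to_le; apply; exists N => // m /= Nm.
  exact: le_trans (L2dot_ge n (Lmn k m)) (ltW (H _ _ Nk Nm)).
exists f.
  have [N HN] := uc 1 ltr01.
  have L : L2 mu (u N - f) by apply: (@bound_L2 _ 1); exact: (key _ N).
  have -> : f = u N - (u N - f) by rewrite opprB addrC subrK.
  exact: (si_B L2_si).
apply/cvgr0Pnorm_le => e e0; have [N HN] := uc _ e0.
exists N => // n /= Nn; have b := key _ _ _ Nn HN.
by rewrite ger0_norm ?(L2dot_ge0 (bound_L2 b))//; exact: L2dot_le.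
Qed.

Lemma L2normE f : L2 mu f -> L2norm mu f ^+ 2 = L2dot mu f f.
Proof. by move=> Lf; rewrite /L2norm sqr_sqrtr// L2dot_ge0. Qed.

Lemma L2norm_lt f e : 0 < e -> (L2norm mu f < e) = (L2dot mu f f < e ^+ 2).
Proof.
by move=> e0; rewrite /L2norm -[in LHS](gtr0_norm e0) -sqrtr_sqr ltr_sqrt ?exprn_gt0.
Qed.

(** Positivity of the weight is carried as an argument so that the type [l2] determines it and its
    norm structure can rely on it. *)
Definition L2pred of (forall i, 0 < mu i) : {pred nat -> R} := mem (L2 mu).

End l2.

Section l2_type.
Context (R : realType) (mu : nat -> R) (mu0 : forall i, 0 < mu i).

Lemma L2_submod_closed : submod_closed (L2pred mu0).
Proof.
split; first by rewrite inE; exact: L2_0.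
by move=> c f g; rewrite !inE; exact: L2_lin.
Qed.

HB.instance Definition _ :=
  GRing.isSubmodClosed.Build R (nat -> R) (L2pred mu0) L2_submod_closed.

Record l2 := L2fun { l2val :> nat -> R; l2valP : l2val \in L2pred mu0 }.

HB.instance Definition _ := [isSub for l2val].
HB.instance Definition _ := [Choice of l2 by <:].
HB.instance Definition _ := [SubChoice_isSubLmodule of l2 by <:].

Lemma l2_L2 (f : l2) : L2 mu f.
Proof. by have := l2valP f; rewrite inE. Qed.

Definition l2dot (f g : l2) : R := L2dot mu f g.

Lemma l2val_lin c (f g : l2) : l2val (c *: f + g) = c *: l2val f + l2val g.
Proof. by []. Qed.

Lemma l2val_scale c (f : l2) : l2val (c *: f) = c *: l2val f.
Proof. by []. Qed.

Lemma l2val_sub (f g : l2) : l2val (f - g) = l2val f - l2val g.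
Proof. by []. Qed.

Lemma l2_si : semi_inner [set: l2] l2dot.
Proof.
split=> //.
- by move=> f g _ _; exact: L2dot_sym.
- by move=> c f g h _ _ _; rewrite /l2dot l2val_lin L2dot_lin//; exact: l2_L2.
- by move=> f _; apply: L2dot_ge0 => //; exact: l2_L2.
Qed.

Definition l2norm (f : l2) : R := L2norm mu f.

Lemma l2_normD f g : l2norm (f + g) <= l2norm f + l2norm g.
Proof.
rewrite -[leRHS]ger0_norm ?addr_ge0 ?sqrtr_ge0// -sqrtr_sqr /l2norm.
rewrite {1}/L2norm ler_wsqrtr// sqrrD (L2normE mu0 (l2_L2 f)) (L2normE mu0 (l2_L2 g)).
have := si_sqDZ l2_si 1 (I : setT f) (I : setT g); rewrite scale1r /l2dot => ->.
have := ler_norm (L2dot mu f g).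
have := si_CS_abs l2_si (I : setT f) (I : setT g).
rewrite -/(L2norm mu f) -/(L2norm mu g); lra.
Qed.

Lemma l2_normZ c f : l2norm (c *: f) = `|c| * l2norm f.
Proof.
rewrite /l2norm /L2norm -/(l2dot _ _) (si_sqZ l2_si)// sqrtrM ?sqr_ge0//.
by rewrite sqrtr_sqr.
Qed.

Lemma l2_norm0_eq0 f : l2norm f = 0 -> f = 0.
Proof.
move=> /(congr1 (fun x => x ^+ 2)); rewrite expr0n /= L2normE//; last exact: l2_L2.
move=> f0; apply/val_inj/funext => i /=.
have := L2dot_ge_term mu0 i (l2_L2 f); rewrite f0 pmulr_rle0// => h.
by apply/eqP; rewrite -sqrf_eq0 eq_le h sqr_ge0.
Qed.

HB.instance Definition _ :=
  Lmodule_isNormed.Build R l2 l2_normD l2_normZ l2_norm0_eq0.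

Lemma l2_normE (f : l2) : `|f| = L2norm mu f.
Proof. by []. Qed.

Lemma l2_ip : inner_product l2dot.
Proof.
split.
- by move=> f g; exact: L2dot_sym.
- by move=> c f g h; exact: (si_bilin l2_si).
- by move=> f; rewrite l2_normE L2normE//; exact: l2_L2.
Qed.

Lemma l2_seq_complete (u : nat -> l2) :
  (forall e : R, 0 < e -> exists N, forall m n, (N <= m)%N -> (N <= n)%N ->
     `|u m - u n| < e) ->
  exists f : l2, forall e : R, 0 < e -> exists N, forall n, (N <= n)%N -> `|u n - f| < e.
Proof.
move=> uc.
have Lu n : L2 mu (u n) by exact: l2_L2.
have [e e0|f Lf uf] := L2_complete mu0 Lu.
  have se0 : 0 < Num.sqrt e by rewrite sqrtr_gt0.
  have [N HN] := uc _ se0; exists N => m n Nm Nn.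
  have := HN _ _ Nm Nn; rewrite l2_normE L2norm_lt// sqr_sqrtr ?ltW//.
have Pf : f \in L2pred mu0 by rewrite inE.
exists (L2fun Pf) => e e0.
move/cvgr0Pnorm_lt : uf => /(_ _ (exprn_gt0 2 e0))[N _ HN].
exists N => n /HN /=; rewrite l2_normE L2norm_lt//.
by apply: le_lt_trans; exact: ler_norm.
Qed.

(** Centres of balls of radius [1/(n+1)] belonging to [F] form a Cauchy sequence, whose limit is
    that of [F]. *)
Lemma l2_complete (F : set_system l2) : ProperFilter F -> cauchy F -> cvg F.
Proof.
move=> FF Fc.
have H n : exists x : l2, F (ball x (n.+1%:R^-1)).
  by have /cauchyP := Fc; apply; rewrite invr_gt0.
have [x xF] := choice H.
have xx m n : `|x m - x n| < m.+1%:R^-1 + n.+1%:R^-1.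
  have [y [ym yn]] := filter_ex (filterI (xF m) (xF n)).
  move: ym yn; rewrite -!ball_normE /= => ym yn.
  by apply: le_lt_trans (ler_distD y _ _) _; rewrite (distrC y); exact: ltrD.
have [e e0|f fx] := l2_seq_complete (u := x).
  have [N HN] := harmonic_small (divr_gt0 e0 (ltr0n _ 2)).
  exists N => m n Nm Nn; apply: lt_trans (xx m n) _.
  by rewrite [ltRHS](splitr e) ltrD// HN.
apply/cvg_ex; exists f; apply/cvgrPdist_lt => /= e e0.
have e20 : 0 < e / 2 by rewrite divr_gt0.
have [N HN] := harmonic_small e20; have [M HM] := fx _ e20.
have := xF (maxn N M); rewrite -ball_normE; apply: filterS => y /= xy.
have := HN _ (leq_maxl N M); have := HM _ (leq_maxr N M) => h1 h2.
apply: le_lt_trans (ler_distD (x (maxn N M)) _ _) _; rewrite (distrC f).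
by rewrite [ltRHS](splitr e) ltrD// (lt_trans xy).
Qed.

HB.instance Definition _ := Uniform_isComplete.Build l2 l2_complete.

End l2_type.

(** * Dirichlet forms on L^2(mu) *)

Section form_norm.
Context (R : realType) (mu : nat -> R) (mu0 : forall i, 0 < mu i).
Implicit Types (E : L2form R) (f g : nat -> R).

Lemma form_norm_lt E f e : L2 mu f -> 0 < e ->
  (form_norm mu E f < e) = (L2dot mu f f + E f f < e ^+ 2).
Proof.
move=> Lf e0; rewrite /form_norm -[in LHS](gtr0_norm e0) -sqrtr_sqr.
by rewrite ltr_sqrt ?exprn_gt0// L2normE.
Qed.

Lemma L2dot_pointwise (u : nat -> nat -> R) f i : (forall n, L2 mu (u n - f)) ->
  (fun n => L2dot mu (u n - f) (u n - f)) @ \oo --> (0 : R) ->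
  (fun n => u n i) @ \oo --> f i.
Proof.
move=> Lu uf; apply/cvgrPdist_lt => e e0.
move/cvgr0Pnorm_lt : uf => /(_ _ (mulr_gt0 (mu0 i) (exprn_gt0 2 e0))).
apply: filterS => n; rewrite ger0_norm ?L2dot_ge0// => H.
rewrite distrC; apply: normr_lt_sqr; first exact: ltW.
rewrite -(ltr_pM2l (mu0 i)); apply: le_lt_trans H.
exact: (L2dot_ge_term mu0 i (Lu n)).
Qed.

Lemma dirichlet_si E : dirichlet_form mu E -> semi_inner (form_dom E) E.
Proof.
move=> dE; split; [exact: df_zero dE|exact: df_lin dE|exact: df_sym dE
  |exact: df_bilin dE|exact: df_ge0 dE].
Qed.

Lemma dirichlet_complete E : dirichlet_form mu E ->
  si_complete (form_dom E) (fun f g => L2dot mu f g + E f g).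
Proof.
move=> dE u Du uc; have hE := dirichlet_si dE.
have L f : form_dom E f -> L2 mu f by exact: (df_L2 dE).
have Dmn m n : form_dom E (u m - u n) by exact: (si_B hE).
have [e e0|f Df uf] := df_closed dE Du.
  have [N HN] := uc _ (exprn_gt0 2 e0); exists N => m n Nm Nn.
  by rewrite form_norm_lt//; [exact: HN|exact: L].
have Duf n : form_dom E (u n - f) by exact: (si_B hE).
exists f => //; apply/cvgr0Pnorm_lt => e e0.
have se0 : 0 < Num.sqrt e by rewrite sqrtr_gt0.
move/cvgr0Pnorm_lt : uf => /(_ _ se0); apply: filterS => n.
rewrite ger0_norm ?sqrtr_ge0// form_norm_lt//; last exact: L.
by rewrite sqr_sqrtr ?ltW// ger0_norm// addr_ge0 ?L2dot_ge0 ?(si_ge0 hE)//; exact: L.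
Qed.

Definition l2_dom E : set (l2 mu0) := [set f | form_dom E f].

Definition l2_form E (f g : l2 mu0) : R := E f g.

Lemma l2_exists f : L2 mu f -> exists g : l2 mu0, l2val g = f.
Proof.
move=> Lf; have Pf : f \in L2pred mu0 by rewrite inE.
by exists (L2fun Pf).
Qed.

Lemma dirichlet_closed_form E : dirichlet_form mu E ->
  closed_form (@l2dot _ _ mu0) (l2_dom E) (l2_form E).
Proof.
move=> dE; have hE := dirichlet_si dE; split.
- split.
  + exact: (si_zero hE).
  + by move=> c f g; exact: (si_lin hE).
  + by move=> f g; exact: (si_sym hE).
  + by move=> c f g h; exact: (si_bilin hE).
  + by move=> f; exact: (si_ge0 hE).
- move=> f e e0; have [g Dg fg] := df_dense dE (l2_L2 f) e0.
  have [g' g'E] := l2_exists (df_L2 dE Dg).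
  by exists g'; rewrite /l2_dom /= ?l2_normE ?l2val_sub g'E.
- move=> u Du uc; have [f Df uf] := dirichlet_complete dE Du uc.
  have [f' f'E] := l2_exists (df_L2 dE Df).
  by exists f'; rewrite /l2_dom /l2dot /l2_form /= f'E.
Qed.

(** Sequences outside [L2 mu] go to 0; operators on [l2] thus become total operators on
    sequences. *)
Definition l2_lift f : l2 mu0 := insubd 0 f.

Lemma l2_liftE f : L2 mu f -> l2val (l2_lift f) = f.
Proof. by move=> Lf; rewrite /l2_lift; apply: (@insubdK _ _ (l2 mu0)); rewrite inE. Qed.

Lemma l2_liftK (f : l2 mu0) : l2_lift f = f.
Proof. by apply: val_inj; rewrite /= l2_liftE//; exact: l2_L2. Qed.

Lemma form_operator_lift E f g : dirichlet_form mu E -> L2 mu f -> L2 mu g ->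
  form_operator mu E f g <->
  form_gen (@l2dot _ _ mu0) (l2_dom E) (l2_form E) (l2_lift f) (l2_lift g).
Proof.
move=> dE Lf Lg; split.
  move=> [Df _ H]; split; first by rewrite /l2_dom /= l2_liftE.
  by move=> k Dk; rewrite /l2_form /l2dot !l2_liftE// H.
move=> [Df H]; rewrite /l2_dom /= l2_liftE// in Df; split=> // h Dh.
have [h' h'E] := l2_exists (df_L2 dE Dh).
by have := H h'; rewrite /l2_dom /l2_form /l2dot /= h'E !l2_liftE//; exact.
Qed.

Lemma dirichlet_semigroup E : dirichlet_form mu E ->
  exists T, semigroup_of mu E T.
Proof.
move=> dE; have cf := dirichlet_closed_form dE.
have [T [sT TP]] := form_semigroupP (l2_ip mu0) cf.
exists (fun t f => l2val (T t (l2_lift f))); split.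
  have liftL c f g : L2 mu f -> L2 mu g ->
      l2_lift (c *: f + g) = c *: l2_lift f + l2_lift g.
    move=> Lf Lg; apply: val_inj; rewrite /= l2_liftE; last exact: L2_lin.
    by rewrite !l2_liftE.
  split.
  - by move=> t f _ _; exact: l2_L2.
  - move=> t c f g t0 Lf Lg; rewrite liftL// (ct_lin (ss_ct sT t0)).
    exact: l2val_lin.
  - by move=> f Lf; rewrite (ss_0 sT) l2_liftE.
  - by move=> s t f s0 t0 Lf; rewrite (ss_add sT)// l2_liftK.
  - move=> t f g t0 Lf Lg; have := ss_sym sT (l2_lift f) (l2_lift g) t0.
    by rewrite /l2dot !l2_liftE.
  - move=> t f t0 Lf; have := ct_le (ss_ct sT t0) (l2_lift f).
    by rewrite !l2_normE l2_liftE.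
  - move=> f Lf; have := ss_cont sT (l2_lift f).
    have -> // : (fun t => `|T t (l2_lift f) - l2_lift f|) =
      (fun t => L2norm mu (l2val (T t (l2_lift f)) - f)).
    by apply/funext => t; rewrite l2_normE l2val_sub l2_liftE.
move=> f g.
have key : L2 mu f -> L2 mu g ->
   (fun t => L2norm mu (t^-1 *: (l2val (T t (l2_lift f)) - f) - g)) =
   (fun t => `|t^-1 *: (T t (l2_lift f) - l2_lift f) - l2_lift g|).
  move=> Lf Lg; apply/funext => t; rewrite l2_normE l2val_sub.
  by rewrite l2val_scale l2val_sub !l2_liftE.
split.
  by move=> [Lf Lg H]; apply/(form_operator_lift dE Lf Lg)/TP; rewrite /sg_gen -key.
move=> H; have [Df Lg _] := H; have Lf := df_L2 dE Df.
by split=> //; rewrite key//; apply/TP/(form_operator_lift dE Lf Lg).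
Qed.

(** Puts a semigroup on sequences into the form required for recovering [E] from it. *)
Lemma semigroup_of_sym E T : dirichlet_form mu E -> semigroup_of mu E T ->
  let S := fun t (f : l2 mu0) => l2_lift (T t f) in
  [/\ forall t (f : nat -> R), 0 <= t -> L2 mu f -> l2val (S t (l2_lift f)) = T t f,
    sym_semigroup (@l2dot _ _ mu0) S &
    forall f g : l2 mu0,
      form_gen (@l2dot _ _ mu0) (l2_dom E) (l2_form E) f g -> sg_gen S f g].
Proof.
move=> dE [sT TP] S.
have SE t (f : l2 mu0) : 0 <= t -> l2val (S t f) = T t f.
  by move=> t0; rewrite /S l2_liftE//; apply: (sg_L2 sT) => //; exact: l2_L2.
split.
- by move=> t f t0 Lf; rewrite SE// l2_liftE.
- split.
  + move=> t t0; split=> [c f g|f].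
      apply: val_inj; rewrite /= SE// (sg_lin sT)//; [|exact: l2_L2|exact: l2_L2].
      by rewrite !SE.
    by rewrite !l2_normE SE// (sg_contr sT)//; exact: l2_L2.
  + by move=> t f g t0; rewrite /l2dot !SE// (sg_sym sT)//; exact: l2_L2.
  + by move=> f; apply: val_inj; rewrite /= SE// (sg_0 sT)//; exact: l2_L2.
  + move=> s t f s0 t0; apply: val_inj; rewrite /= !SE ?addr_ge0//.
    by rewrite (sg_add sT)//; exact: l2_L2.
  + move=> f; apply: cvg_trans (sg_cont sT (l2_L2 f)); apply: near_eq_cvg; near=> t.
    have t0 : 0 < t by [].
    by rewrite l2_normE l2val_sub SE// ltW.
- move=> f g [Df H].
  have /TP[_ _] : form_operator mu E f g.
    split=> //; first exact: l2_L2.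
    move=> h Dh; have [h' h'E] := l2_exists (df_L2 dE Dh).
    by have := H h'; rewrite /l2_dom /l2_form /l2dot /= h'E; apply.
  apply: cvg_trans; apply: near_eq_cvg; near=> t.
  have t0 : 0 < t by [].
  rewrite l2_normE l2val_sub.
  by rewrite l2val_scale l2val_sub SE// ltW.
Unshelve. all: by end_near. Qed.

End form_norm.

(** * Birth-death forms *)

Lemma fin_supportP (R : realType) (f : nat -> R) :
  fin_support f <-> exists n, forall i, (n <= i)%N -> f i = 0.
Proof.
split.
  move=> /finite_setP[n fn].
  have : finite_set [set i | f i != 0] by apply/finite_setP; exists n.
  move=> /finite_seqP[s sE]; exists (\max_(i <- s) i).+1 => i.
  rewrite ltnNge; apply: contraNeq => fi.
  have : [set i | f i != 0] i by [].
  by rewrite sE /= => si; exact: (@leq_bigmax_seq _ s predT id).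
move=> [n fn]; apply: (@sub_finite_set _ _ `I_n); last exact: finite_II.
by move=> i /=; apply: contraNltn => ni; rewrite fn.
Qed.

Lemma fin_support_lin (R : realType) (c : R) (f g : nat -> R) :
  fin_support f -> fin_support g -> fin_support (c *: f + g).
Proof.
move=> /fin_supportP[n fn] /fin_supportP[m gm]; apply/fin_supportP.
exists (maxn n m) => i; rewrite geq_max => /andP[ni mi].
by rewrite -[LHS]/(c * f i + g i) fn// gm// mulr0 addr0.
Qed.

(** Weighted Cauchy-Schwarz. The induction step is [2 S y <= A u y^2 + B v], which follows from
    [S^2 <= A B] and [u v = 1]. *)
Lemma sqr_sum_le (R : realType) (w x : nat -> R) n : (forall i, 0 < w i) ->
  (\sum_(0 <= i < n) x i) ^+ 2 <=
  (\sum_(0 <= i < n) (w i)^-1) * (\sum_(0 <= i < n) w i * x i ^+ 2).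
Proof.
move=> w0; elim: n => [|n IH]; first by rewrite !big_nil expr0n mul0r.
rewrite !big_nat_recr//=.
have A0 : 0 <= \sum_(0 <= i < n) (w i)^-1.
  by apply: sumr_ge0 => i _; rewrite invr_ge0 ltW.
have B0 : 0 <= \sum_(0 <= i < n) w i * x i ^+ 2.
  by apply: sumr_ge0 => i _; rewrite mulr_ge0 ?sqr_ge0// ltW.
move: (\sum_(0 <= i < n) x i) (\sum_(0 <= i < n) (w i)^-1)
  (\sum_(0 <= i < n) w i * x i ^+ 2) IH A0 B0 => S A B IH A0 B0.
have w1 := w0 n; have v0 : 0 < (w n)^-1 by rewrite invr_gt0.
have wv : w n * (w n)^-1 = 1 by rewrite divff// gt_eqF.
move: (w n) (w n)^-1 (x n) w1 v0 wv => u v y u0 v0 uv.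
have H : `|2 * S * y| <= A * u * y ^+ 2 + B * v.
  apply: normr_le_sqr.
    apply: addr_ge0; last by apply: mulr_ge0 => //; exact: ltW.
    by apply: mulr_ge0; [apply: mulr_ge0 => //; exact: ltW|exact: sqr_ge0].
  have h1 : S ^+ 2 * y ^+ 2 <= A * B * y ^+ 2 by rewrite ler_wpM2r ?sqr_ge0.
  have h2 := sqr_ge0 (A * u * y ^+ 2 - B * v).
  have h3 : A * u * y ^+ 2 * (B * v) = A * B * y ^+ 2.
    by rewrite -[RHS]mulr1 -uv; ring.
  have -> : (A * u * y ^+ 2 + B * v) ^+ 2 =
     (A * u * y ^+ 2 - B * v) ^+ 2 + 4 * (A * u * y ^+ 2 * (B * v)) by ring.
  by rewrite h3; lra.
have := le_trans (ler_norm _) H.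
have -> : (A + v) * (B + u * y ^+ 2) =
  A * B + A * u * y ^+ 2 + B * v + (u * v) * y ^+ 2 by ring.
by rewrite uv; lra.
Qed.

Section birth_death.
Context (R : realType) (a b : nat -> R).
Hypotheses (hb : forall i, 0 < b i) (ha : forall i, (1 <= i)%N -> 0 < a i)
  (ha0 : a 0%N = 0).
Implicit Types (f g : nat -> R).

Local Notation mu := (bd_mu a b).
Local Notation w := (fun i => bd_mu a b i * b i).
Local Notation d f := (fun i : nat => f i.+1 - f i).

Lemma bd_mu0 : mu 0 = 1.
Proof. by rewrite /bd_mu !big_geq// divr1. Qed.

Lemma bd_mu_gt0 i : 0 < mu i.
Proof.
apply: divr_gt0; first by apply: prodr_gt0.
by rewrite big_nat_cond; apply: prodr_gt0 => j /andP[/andP[/ha]].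
Qed.

(** Detailed balance: it makes [Q] symmetric with respect to [mu]. *)
Lemma bd_muS i : mu i.+1 * a i.+1 = mu i * b i.
Proof.
rewrite /bd_mu [\prod_(0 <= j < i.+1) b j]big_nat_recr//=.
rewrite [\prod_(1 <= j < i.+2) a j]big_nat_recr//= invfM.
set p := \prod_(0 <= j < i) _; set q := (\prod_(1 <= j < i.+1) _)^-1.
have ai : a i.+1 != 0 by rewrite gt_eqF// ha.
by rewrite -mulrA -[q / _ * _]mulrA mulVf// mulr1 mulrAC.
Qed.

Lemma bd_w_gt0 i : 0 < w i.
Proof. by rewrite mulr_gt0// bd_mu_gt0. Qed.

Lemma d_lin c f g : d (c *: f + g) = c *: d f + d g.
Proof.
apply/funext => i; rewrite -[RHS]/(c * (f i.+1 - f i) + (g i.+1 - g i)).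
by rewrite -[LHS]/(c * f i.+1 + g i.+1 - (c * f i + g i)); ring.
Qed.

Lemma d_sub f g : d (f - g) = d f - d g.
Proof.
apply/funext => i; rewrite -[RHS]/((f i.+1 - f i) - (g i.+1 - g i)).
by rewrite -[LHS]/((f i.+1 - g i.+1) - (f i - g i)); ring.
Qed.

(** Convertible to the domain of [bd_max_form]; finite energy is read as [d f] being square summable
    for the edge weights [w], so that the results on [L2] apply to both conditions. *)
Definition bd_max_dom : set (nat -> R) := [set f | L2 mu f /\ L2 w (d f)].

Lemma bd_max_dom_fin f n : (forall i, (n <= i)%N -> f i = 0) -> bd_max_dom f.
Proof.
move=> f0; split; first exact: (L2_fin bd_mu_gt0 f0).
by apply: (L2_fin bd_w_gt0 (n := n)) => i ni; rewrite !f0 ?subr0// ltnW// ltnS.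
Qed.

Definition bd_form f g : R := L2dot w (d f) (d g).

Lemma bd_form_si : semi_inner bd_max_dom bd_form.
Proof.
split.
- exact: (@bd_max_dom_fin 0 0).
- move=> c f g [Lf Df] [Lg Dg]; split; first exact: L2_lin bd_mu_gt0 _ _ _ Lf Lg.
  by rewrite d_lin; exact: L2_lin bd_w_gt0 _ _ _ Df Dg.
- by move=> f g _ _; exact: L2dot_sym.
- move=> c f g h [_ Df] [_ Dg] [_ Dh].
  by rewrite /bd_form d_lin L2dot_lin//; exact: bd_w_gt0.
- by move=> f [_ Df]; apply: L2dot_ge0 Df; exact: bd_w_gt0.
Qed.

Lemma bd_max_dom_le f g : (forall i, `|f i| <= `|g i|) ->
  (forall i, `|d f i| <= `|d g i|) -> bd_max_dom g -> bd_max_dom f.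
Proof.
move=> fg dfg [Lg Dg]; split; first exact: (L2_le bd_mu_gt0 fg).
exact: (L2_le bd_w_gt0 dfg).
Qed.

Lemma bd_form_le f g : (forall i, `|d f i| <= `|d g i|) ->
  bd_max_dom g -> bd_form f f <= bd_form g g.
Proof.
move=> fg [_ Dg]; apply: (L2dot_le bd_w_gt0) => n.
apply: le_trans (L2dot_ge bd_w_gt0 n Dg); apply: ler_sum => i _.
by rewrite ler_wpM2l ?(ltW (bd_w_gt0 i))// ler_norm_sqr.
Qed.

Lemma bd_max_complete (u : nat -> nat -> R) : (forall n, bd_max_dom (u n)) ->
  (forall e : R, 0 < e -> exists N, forall m n, (N <= m)%N -> (N <= n)%N ->
    L2dot mu (u m - u n) (u m - u n) + bd_form (u m - u n) (u m - u n) < e) ->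
  exists2 f, bd_max_dom f &
    (fun n => L2dot mu (u n - f) (u n - f) + bd_form (u n - f) (u n - f)) @ \oo --> (0 : R).
Proof.
move=> Du uc.
have Dmn m n : bd_max_dom (u m - u n) by exact: (si_B bd_form_si).
have [|e e0|f Lf uf] := L2_complete bd_mu_gt0 (u := u).
- by move=> n; case: (Du n).
- have [N HN] := uc _ e0; exists N => m n Nm Nn.
  by apply: le_lt_trans (HN _ _ Nm Nn); rewrite lerDl (si_ge0 bd_form_si).
have [|e e0|g Lg ug] := L2_complete bd_w_gt0 (u := fun n => d (u n)).
- by move=> n; case: (Du n).
- have [N HN] := uc _ e0; exists N => m n Nm Nn.
  rewrite -d_sub; apply: le_lt_trans (HN _ _ Nm Nn).
  by rewrite lerDr (L2dot_ge0 bd_mu_gt0)//; case: (Dmn m n).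
have Lu n : L2 mu (u n) by case: (Du n).
have Ldu n : L2 w (d (u n)) by case: (Du n).
have pf i : (fun n => u n i) @ \oo --> f i.
  by apply: (L2dot_pointwise bd_mu_gt0) uf => n; exact: (si_B (L2_si bd_mu_gt0)).
have pg i : (fun n => d (u n) i) @ \oo --> g i.
  by apply: (L2dot_pointwise bd_w_gt0) ug => n; exact: (si_B (L2_si bd_w_gt0)).
(* The difference operator is closed: both limits are pointwise limits, so the second is the
   difference of the first. *)
have gE : g = d f.
  apply/funext => i; apply: cvg_unique (pg i) _ => //.
  by apply: cvgB; exact: pf.
exists f; first by split; rewrite // -gE.
rewrite -[0 in X in _ --> X]addr0; apply: cvgD => //.
by apply: cvg_trans ug; apply: near_eq_cvg; apply: nearW => n; rewrite /bd_form d_sub gE.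
Qed.

Lemma clip_dist (x y : R) :
  `|Num.min (Num.max x 0) 1 - Num.min (Num.max y 0) 1| <= `|x - y|.
Proof.
rewrite !ler_norml; have := ler_norm (x - y); have := ler_norm (y - x).
rewrite (distrC y); rewrite /Num.min /Num.max => h1 h2.
case: (ltP x 0) => ?; case: (ltP y 0) => ?; do ?case: ltP => ?; lra.
Qed.

Lemma clip_le (x : R) : `|Num.min (Num.max x 0) 1| <= `|x|.
Proof.
by have := clip_dist x 0; rewrite maxxx [Num.min 0 1]min_l// !subr0.
Qed.

(** * Restrictions of the maximal form to a closed, solid space of sequences *)

Section restriction.
Context (S : set (nat -> R)).
Hypothesis S_lin : forall c f g, S f -> S g -> S (c *: f + g).
Hypothesis S_fin : forall f n, (forall i, (n <= i)%N -> f i = 0) -> S f.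
Hypothesis S_le : forall f g, (forall i, `|f i| <= `|g i|) -> S g -> S f.
Hypothesis S_closed : forall (u : nat -> nat -> R) f, (forall n, S (u n)) ->
  (forall n, bd_max_dom (u n - f)) ->
  (fun n => L2dot mu (u n - f) (u n - f) + bd_form (u n - f) (u n - f)) @ \oo --> (0 : R) ->
  S f.

Definition bd_restricted_form : L2form R :=
  Form (form_dom (bd_max_form a b) `&` S) (bd_max_form a b).

Lemma bd_restricted_dirichlet : dirichlet_form mu bd_restricted_form.
Proof.
have hD := bd_form_si.
split.
- by move=> f [[]].
- by split; [exact: (si_zero hD)|exact: (S_fin (n := 0))].
- by move=> c f g [Df Sf] [Dg Sg]; split; [exact: (si_lin hD)|exact: S_lin].
- move=> f Lf e e0; have [N HN] := trunc_small bd_mu_gt0 Lf (exprn_gt0 2 e0).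
  have t0 i : (N <= i)%N -> trunc N f i = 0 by rewrite /trunc ltnNge => ->.
  exists (trunc N f); first by split; [exact: (bd_max_dom_fin t0)|exact: S_fin t0].
  by rewrite L2norm_lt ?HN//; exact: bd_mu_gt0.
- by move=> f g [Df _] [Dg _]; exact: (si_sym hD).
- by move=> c f g h [Df _] [Dg _] [Dh _]; exact: (si_bilin hD).
- by move=> f [Df _]; exact: (si_ge0 hD).
- move=> u Du uc.
  have Du' n : bd_max_dom (u n) by case: (Du n).
  have Dmn m n : bd_max_dom (u m - u n) by exact: (si_B hD).
  have [e e0|f Df uf] := bd_max_complete Du'.
    have se0 : 0 < Num.sqrt e by rewrite sqrtr_gt0.
    have [N HN] := uc _ se0; exists N => m n Nm Nn; have := HN m n Nm Nn.
    rewrite (form_norm_lt bd_mu_gt0) ?sqr_sqrtr ?ltW//.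
    by case: (Dmn m n).
  have Duf n : bd_max_dom (u n - f) by exact: (si_B hD).
  exists f.
    by split=> //; apply: S_closed Duf uf => n; case: (Du n).
  apply/cvgr0Pnorm_lt => e e0.
  move/cvgr0Pnorm_lt : uf => /(_ _ (exprn_gt0 2 e0)); apply: filterS => n H.
  rewrite ger0_norm ?sqrtr_ge0// (form_norm_lt bd_mu_gt0)//; last by case: (Duf n).
  exact: le_lt_trans (ler_norm _) H.
- move=> f [Df Sf] f1.
  have h1 i : `|f1 i| <= `|f i| by exact: clip_le.
  have h2 i : `|d f1 i| <= `|d f i| by exact: clip_dist.
  split; last exact: bd_form_le.
  by split; [exact: bd_max_dom_le Df|exact: S_le Sf].
Qed.

End restriction.

Lemma bd_max_form_restricted : bd_max_form a b = bd_restricted_form setT.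
Proof. by rewrite /bd_restricted_form setIT. Qed.

Lemma bd_max_dirichlet : dirichlet_form mu (bd_max_form a b).
Proof. by rewrite bd_max_form_restricted; exact: bd_restricted_dirichlet. Qed.

(** [f i] is [f 0] plus a sum of increments. Since [mu 0 = 1], the square of [f 0] is at most the
    squared norm; weighted Cauchy-Schwarz bounds the square of the sum by [M] times the energy. The
    factor 2 is that of [(x + s)^2 <= 2 x^2 + 2 s^2]. *)
Lemma bd_sup_bound (M : R) f i : (forall n, \sum_(0 <= i < n) (w i)^-1 <= M) ->
  bd_max_dom f ->
  f i ^+ 2 <= (2 + 2 * M) * (L2dot mu f f + bd_form f f).
Proof.
move=> wM [Lf Df].
have fi : f i = f 0%N + \sum_(0 <= j < i) d f j.
  by rewrite telescope_sumr// addrC subrK.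
have H0 := L2dot_ge_term bd_mu_gt0 0 Lf; rewrite bd_mu0 mul1r in H0.
have H1 := sqr_sum_le (d f) i bd_w_gt0.
have H2 := L2dot_ge bd_w_gt0 i Df; rewrite -/(bd_form f f) in H2.
have M0 : 0 <= M by have := wM 0%N; rewrite big_nil.
have F0 := L2dot_ge0 bd_mu_gt0 Lf; have D0 := L2dot_ge0 bd_w_gt0 Df.
rewrite -/(bd_form f f) in D0.
have s0 : 0 <= \sum_(0 <= j < i) (w j)^-1.
  by apply: sumr_ge0 => j _; rewrite invr_ge0 (ltW (bd_w_gt0 j)).
have s1 : 0 <= \sum_(0 <= j < i) w j * d f j ^+ 2.
  by apply: sumr_ge0 => j _; rewrite mulr_ge0 ?sqr_ge0// (ltW (bd_w_gt0 j)).
have H3 := le_trans H1 (ler_pM s0 s1 (wM i) H2).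
rewrite fi; have := sqr_ge0 (f 0%N - \sum_(0 <= j < i) d f j).
move: (\sum_(0 <= j < i) d f j) (f 0%N) (L2dot mu f f) (bd_form f f) H0 H3 F0 D0.
move=> s x F D' H0 H3 F0 D0 H4.
have : 0 <= M * F by exact: mulr_ge0.
lra.
Qed.

(** * Unit functions and the columns of [Q] *)

Local Notation unit := (@unit_fun R).
Local Notation Qcol j := (fun i : nat => bd_Q a b i j).

Lemma unit_out j i : (j < i)%N -> unit j i = 0.
Proof. by move=> ji; rewrite /unit_fun gtn_eqF. Qed.

Lemma L2dot_unit (nu : nat -> R) f j : L2dot nu f (unit j) = nu j * f j.
Proof.
rewrite L2dot_sym (L2dot_fin _ _ (n := j.+1)); last exact: unit_out.
rewrite big_nat_recr//= /unit_fun eqxx mulr1 big_nat_cond big1 ?add0r//.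
by move=> i /andP[/andP[_ ij] _]; rewrite ltn_eqF// mulr0 mul0r.
Qed.

Lemma bd_form_unit f j :
  bd_form f (unit j) = (if j is k.+1 then w k * d f k else 0) - w j * d f j.
Proof.
rewrite /bd_form L2dot_sym (L2dot_fin _ _ (n := j.+1)); last first.
  by move=> i ji; rewrite !unit_out ?subr0// ltnW// ltnS.
case: j => [|k].
  by rewrite big_nat1 /unit_fun /=; ring.
rewrite !big_nat_recr//= big_nat_cond big1 ?add0r; last first.
  move=> i /andP[/andP[_ ik] _].
  by rewrite /unit_fun eqSS ltn_eqF// ltn_eqF ?subrr ?mulr0 ?mul0r// ltnS ltnW.
have -> : unit k.+1 k = 0 by rewrite /unit_fun ltn_eqF.
have -> : unit k.+1 k.+2 = 0 by rewrite /unit_fun gtn_eqF.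
have -> : unit k.+1 k.+1 = 1 by rewrite /unit_fun eqxx.
ring.
Qed.

Lemma bd_QU i : bd_Q a b i i.+1 = b i.
Proof. by rewrite /bd_Q eqxx. Qed.

Lemma bd_QL i : bd_Q a b i.+1 i = a i.+1.
Proof. by rewrite /bd_Q ltn_eqF// eqxx. Qed.

Lemma bd_QD i : bd_Q a b i i = - (a i + b i).
Proof. by rewrite /bd_Q ltn_eqF// gtn_eqF// eqxx. Qed.

Lemma bd_Q_above i j : (i.+1 < j)%N -> bd_Q a b i j = 0.
Proof.
by move=> ij; rewrite /bd_Q gtn_eqF// gtn_eqF ?gtn_eqF//; apply: ltnW => //; rewrite ltnS ltnW// ltnW.
Qed.

Lemma bd_Q_below i j : (j.+1 < i)%N -> bd_Q a b i j = 0.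
Proof.
move=> ji; have ji' : (j < i)%N by exact: ltnW.
by rewrite /bd_Q !ltn_eqF// ltnS ltnW.
Qed.

Lemma bd_form_sym f g : bd_form f g = bd_form g f.
Proof. exact: L2dot_sym. Qed.

(** Summation by parts and detailed balance: column [j] of [Q] is the generator applied to the unit
    function at [j]. *)
Lemma bd_form_unitQ j f : bd_form (unit j) f = - L2dot mu (Qcol j) f.
Proof.
rewrite bd_form_sym bd_form_unit (L2dot_fin _ _ (n := j.+2)); last first.
  by move=> i ji; rewrite bd_Q_below.
case: j => [|k].
  (* At the left end the diagonal entry is [- b 0], by the convention [a 0 = 0]. *)
  rewrite !big_nat_recr//= big_nil bd_QD bd_QL ha0 add0r bd_muS; ring.
rewrite !big_nat_recr//= big_nat_cond big1; last first.
  by move=> i /andP[/andP[_ ik] _]; rewrite bd_Q_above ?mulr0 ?mul0r.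
rewrite bd_QU bd_QD bd_QL bd_muS.
have -> : mu k.+1 * - (a k.+1 + b k.+1) = - (mu k * b k + mu k.+1 * b k.+1).
  by rewrite -bd_muS; ring.
ring.
Qed.

Lemma Qcol_L2 j : L2 mu (Qcol j).
Proof. by apply: (L2_fin bd_mu_gt0 (n := j.+2)) => i ji; rewrite bd_Q_below. Qed.

Lemma unit_L2 j : L2 mu (unit j).
Proof. by apply: (L2_fin bd_mu_gt0 (n := j.+1)) => i; exact: unit_out. Qed.

Lemma corresponds_of_operator E : dirichlet_form mu E ->
  (forall j, form_operator mu E (unit j) (Qcol j)) -> corresponds_to_rates a b E.
Proof.
move=> dE EQ; split=> //; have [T ET] := dirichlet_semigroup bd_mu_gt0 dE.
exists T => // i j; have [sT TP] := ET.
have /TP[_ _ H] := EQ j.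
rewrite /transition_fun (sg_0 sT (unit_L2 j)).
apply/cvgrPdist_lt => e e0.
have m0 := bd_mu_gt0 i.
(* An L2 error below this bound is an error below [e] in coordinate [i]. *)
have d0 : 0 < Num.sqrt (mu i * e ^+ 2) by rewrite sqrtr_gt0 mulr_gt0// exprn_gt0.
move/cvgr0Pnorm_lt : H => /(_ _ d0) H; near=> t.
have t0 : 0 < t by [].
have : `|L2norm mu (t^-1 *: (T t (unit j) - unit j) - Qcol j)| <
  Num.sqrt (mu i * e ^+ 2) by near: t.
rewrite ger0_norm ?sqrtr_ge0// L2norm_lt// sqr_sqrtr; last first.
  exact: (mulr_ge0 (ltW m0) (sqr_ge0 e)).
have Lx : L2 mu (t^-1 *: (T t (unit j) - unit j) - Qcol j).
  apply: (si_B (L2_si bd_mu_gt0)); last exact: Qcol_L2.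
  apply: (si_Z (L2_si bd_mu_gt0)); apply: (si_B (L2_si bd_mu_gt0)); last exact: unit_L2.
  by apply: (sg_L2 sT); [exact: ltW|exact: unit_L2].
have H1 := L2dot_ge_term bd_mu_gt0 i Lx => H2.
rewrite distrC; apply: normr_lt_sqr; first exact: ltW.
rewrite -(ltr_pM2l m0); exact: le_lt_trans H1 H2.
Unshelve. all: by end_near. Qed.

Lemma bd_restricted_corresponds S :
  (forall f n, (forall i, (n <= i)%N -> f i = 0) -> S f) ->
  dirichlet_form mu (bd_restricted_form S) ->
  corresponds_to_rates a b (bd_restricted_form S).
Proof.
move=> S_fin dS; apply: corresponds_of_operator => // j; split.
- have u0 i : (j.+1 <= i)%N -> unit j i = 0 by exact: unit_out.
  by split; [exact: (bd_max_dom_fin u0)|exact: (S_fin _ _ u0)].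
- exact: Qcol_L2.
- by move=> h _; exact: bd_form_unitQ.
Qed.

Lemma bd_max_corresponds : corresponds_to_rates a b (bd_max_form a b).
Proof.
rewrite bd_max_form_restricted; apply: bd_restricted_corresponds => //.
by rewrite -bd_max_form_restricted; exact: bd_max_dirichlet.
Qed.

(** * Density of finitely supported functions in the divergent case *)

Lemma harmonic_eq0 v : bd_max_dom v ->
  (forall j, L2dot mu v (unit j) + bd_form v (unit j) = 0) ->
  (\sum_(0 <= k <oo) ((b k * mu k)^-1 + mu k)%:E = +oo)%E -> v = 0.
Proof.
move=> [Lv Dv] vP soo.
pose F n := w n * d v n.
have F0 : F 0%N = v 0%N.
  have := vP 0%N; rewrite L2dot_unit bd_form_unit sub0r bd_mu0 mul1r => /eqP.
  by rewrite subr_eq0 => /eqP; rewrite /F bd_mu0.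
have FS n : F n.+1 = F n + mu n.+1 * v n.+1.
  have := vP n.+1; rewrite L2dot_unit bd_form_unit /F addrA => /eqP.
  by rewrite subr_eq0 addrC => /eqP.
have vS n : v n.+1 = v n + (w n)^-1 * F n.
  by rewrite /F mulKf ?gt_eqF ?bd_w_gt0// addrC subrK.
have v00 : v 0%N = 0.
  apply/eqP/negPn/negP => v0.
  have s0 : 0 < v 0%N ^+ 2 by rewrite lt0r sqrf_eq0 v0 sqr_ge0.
  (* The factor [v 0] treats both signs at once. The increment of [v] is a positive multiple of [F],
     and that of [F] a positive multiple of the new [v]. *)
  have key n : v 0%N ^+ 2 <= v n * v 0%N /\ v 0%N ^+ 2 <= F n * v 0%N.
    elim: n => [|n [IH1 IH2]]; first by rewrite F0 expr2.
    have h1 : v 0%N ^+ 2 <= v n.+1 * v 0%N.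
      rewrite vS mulrDl -mulrA; apply: le_trans IH1 _; rewrite lerDl mulr_ge0//.
        by rewrite invr_ge0 (ltW (bd_w_gt0 n)).
      by apply: le_trans IH2; exact: ltW.
    split=> //; rewrite FS mulrDl -mulrA; apply: le_trans IH2 _; rewrite lerDl mulr_ge0//.
      exact: ltW (bd_mu_gt0 _).
    by apply: le_trans h1; exact: ltW.
  have sq x : v 0%N ^+ 2 <= x * v 0%N -> v 0%N ^+ 2 <= x ^+ 2.
    move=> H; have := sqr_ge0 (x - v 0%N); lra.
  have b0 k : 0 <= (b k * mu k)^-1 + mu k.
    apply: addr_ge0; last exact: (ltW (bd_mu_gt0 k)).
    by rewrite invr_ge0; exact: (mulr_ge0 (ltW (hb k)) (ltW (bd_mu_gt0 k))).
  suff : (\sum_(0 <= k <oo) ((b k * mu k)^-1 + mu k)%:E < +oo)%E by rewrite soo.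
  apply: (bound_nneseries_lty (M := (L2dot mu v v + bd_form v v) / v 0%N ^+ 2)) => // n.
  rewrite ler_pdivlMr//.
  apply: le_trans (lerD (L2dot_ge bd_mu_gt0 n Lv) (L2dot_ge bd_w_gt0 n Dv)).
  rewrite mulr_suml -big_split /=; apply: ler_sum => i _.
  have [/sq k1 /sq k2] := key i.
  have p1 := ler_wpM2l (ltW (bd_mu_gt0 i)) k1.
  have p2 : (mu i * b i)^-1 * v 0%N ^+ 2 <= mu i * b i * (v i.+1 - v i) ^+ 2.
    have -> : mu i * b i * (v i.+1 - v i) ^+ 2 = (mu i * b i)^-1 * F i ^+ 2.
      rewrite /F; have := bd_w_gt0 i.
      by move: (mu i * b i) (v i.+1 - v i) => x y x0; field; rewrite gt_eqF.
    by rewrite ler_wpM2l// invr_ge0 (ltW (bd_w_gt0 i)).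
  by rewrite mulrDl addrC (mulrC (b i)); exact: lerD.
have H n : v n = 0 /\ F n = 0.
  elim: n => [|n [v0 Fn]]; first by rewrite F0 v00.
  have h : v n.+1 = 0 by rewrite vS v0 Fn mulr0 addr0.
  by rewrite FS h mulr0 addr0.
by apply/funext => n; case: (H n).
Qed.

Lemma fin_support_max f : fin_support f -> bd_max_dom f.
Proof. by move=> /fin_supportP[n]; exact: bd_max_dom_fin. Qed.

Lemma bd_fin_support_dense :
  (\sum_(0 <= k <oo) ((b k * mu k)^-1 + mu k)%:E = +oo)%E ->
  forall f, bd_max_dom f -> forall e, 0 < e ->
  exists2 g, fin_support g & L2dot mu (f - g) (f - g) + bd_form (f - g) (f - g) < e.
Proof.
move=> soo f Df.
have dE := bd_max_dirichlet.
have hB : semi_inner bd_max_dom (fun f g => L2dot mu f g + bd_form f g).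
  have := semi_inner_comb ler01
    (semi_inner_sub (L2_si bd_mu_gt0) (df_L2 dE) (si_zero bd_form_si) (si_lin bd_form_si))
    bd_form_si.
  by congr semi_inner; apply/funext => x; apply/funext => y; rewrite mul1r.
have Bc : si_complete bd_max_dom (fun f g => L2dot mu f g + bd_form f g).
  exact: (dirichlet_complete bd_mu_gt0 dE).
have [||||||u [Du uP uK]] := @riesz _ _ bd_max_dom (@fin_support R) _
  (fun g => L2dot mu f g + bd_form f g) (L2dot mu f f + bd_form f f) hB Bc.
- exact: (si_ge0 hB).
- exact: fin_support_max.
- by apply/fin_supportP; exists 0%N.
- exact: fin_support_lin.
- move=> c x y /fin_support_max Dx /fin_support_max Dy.
  rewrite (si_sym hB Df (si_lin hB c Dx Dy)) (si_bilin hB)//.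
  by rewrite (si_sym hB Dx)// (si_sym hB Dy).
- by move=> g /fin_support_max Dg; exact: (si_CS hB).
(* [u] is the projection of [f] on the closure of the finitely supported functions, so [f - u] is
   orthogonal to every unit function. *)
suff -> : f = u by [].
apply/eqP; rewrite -subr_eq0; apply/eqP; apply: harmonic_eq0 => //.
  exact: (si_B hB).
move=> j; have Kj : fin_support (unit j).
  by apply/fin_supportP; exists j.+1 => i; exact: unit_out.
have Dj := fin_support_max Kj.
by rewrite (siBl hB Df Du Dj) (uP _ Kj) subrr.
Qed.

Lemma bd_regular_of_infinite :
  (\sum_(0 <= k <oo) ((b k * mu k)^-1 + mu k)%:E = +oo)%E ->
  regular_form mu (bd_max_form a b).
Proof.
move=> soo; split; first exact: fin_support_max.
move=> f Df e e0; have [g Kg H] := bd_fin_support_dense soo Df (exprn_gt0 2 e0).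
exists g => //; rewrite (form_norm_lt bd_mu_gt0)//.
by have [] := si_B bd_form_si Df (fin_support_max Kg).
Qed.

(** * The convergent case: failure of regularity and of uniqueness *)

Lemma bd_finite_bounds :
  (\sum_(0 <= k <oo) ((b k * mu k)^-1 + mu k)%:E < +oo)%E ->
  (exists M, forall n, \sum_(0 <= i < n) (w i)^-1 <= M) /\
  bd_max_dom (fun=> 1).
Proof.
move=> sfin.
have m0 k : 0 <= mu k by rewrite ltW// bd_mu_gt0.
have w0 k : 0 <= (b k * mu k)^-1 by rewrite invr_ge0 mulr_ge0// ltW.
have [M HM] := nneseries_lty_bound (fun k => addr_ge0 (w0 k) (m0 k)) sfin.
split.
  exists M => n; apply: le_trans (HM n); apply: ler_sum => i _.
  by rewrite mulrC lerDl.
split.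
  apply: (bound_L2 bd_mu_gt0 (M := M)) => n; apply: le_trans (HM n).
  by apply: ler_sum => i _; rewrite expr1n mulr1 lerDr.
apply: (bound_L2 bd_w_gt0 (M := 0)) => n; rewrite big1// => i _.
by rewrite subrr expr0n mulr0.
Qed.

(** The constant 1 has no approximation: at a point outside the support of [g], [1 - g] equals 1,
    whereas a form distance below the root of [1/C] would make it less than 1 in absolute value. *)
Lemma bd_not_regular :
  (\sum_(0 <= k <oo) ((b k * mu k)^-1 + mu k)%:E < +oo)%E ->
  ~ regular_form mu (bd_max_form a b).
Proof.
move=> /bd_finite_bounds[[M wM] D1] [_ reg].
have M0 : 0 <= M by have := wM 0%N; rewrite big_nil.
pose C := 2 + 2 * M; have C0 : 0 < C by rewrite /C; lra.
have e0 : 0 < Num.sqrt C^-1 by rewrite sqrtr_gt0 invr_gt0.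
have [g Kg] := reg _ D1 _ e0.
have D1g := si_B bd_form_si D1 (fin_support_max Kg).
rewrite (form_norm_lt bd_mu_gt0)//; last by case: D1g.
rewrite sqr_sqrtr ?invr_ge0 ?(ltW C0)// => H.
have [n gn] := (fin_supportP g).1 Kg.
have := bd_sup_bound n wM D1g; rewrite -/C.
rewrite -[X in X ^+ 2]/(1 - g n) gn// subr0 expr1n.
by move/le_lt_trans => /(_ 1); rewrite ltxx -[ltRHS](divff (lt0r_neq0 C0)) ltr_pM2l// => /(_ H).
Qed.

(** An explicit condition, taken instead of the closure of [fin_support], because it is visibly
    inherited under [|f| <= |g|], hence by clipping. *)
Definition vanishing : set (nat -> R) := [set f | f @ \oo --> (0 : R)].

Lemma bd_vanishing_dirichlet :
  (\sum_(0 <= k <oo) ((b k * mu k)^-1 + mu k)%:E < +oo)%E ->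
  dirichlet_form mu (bd_restricted_form vanishing).
Proof.
move=> /bd_finite_bounds[[M wM] _].
have M0 : 0 <= M by have := wM 0%N; rewrite big_nil.
pose C := 2 + 2 * M; have C0 : 0 < C by rewrite /C; lra.
apply: bd_restricted_dirichlet.
- move=> c f g f0 g0; rewrite /vanishing /= -[0 in X in _ --> X](addr0 0) -{1}(mulr0 c).
  by apply: cvgD => //; exact: cvgMl_tmp.
- by move=> f n fn; apply: cvg_near_cst; exists n.
- move=> f g fg /cvgr0Pnorm_lt g0; apply/cvgr0Pnorm_lt => e /g0.
  by apply: filterS => n; exact: le_lt_trans.
move=> u f Su Duf uf; apply/cvgr0Pnorm_lt => e e0.
have e20 : 0 < e / 2 by rewrite divr_gt0.
have d0 : 0 < (e / 2) ^+ 2 / C by rewrite divr_gt0// exprn_gt0.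
move/cvgr0Pnorm_lt : uf => /(_ _ d0)[N _ /(_ N (leqnn N)) HN].
have /cvgr0Pnorm_lt/(_ _ e20) := Su N; apply: filterS => n H1.
have H2 : `|(u N - f) n| < e / 2.
  apply: normr_lt_sqr; first exact: ltW.
  apply: le_lt_trans (bd_sup_bound n wM (Duf N)) _.
  rewrite mulrC -ltr_pdivlMr//; exact: le_lt_trans (ler_norm _) HN.
have -> : f n = u N n - (u N - f) n.
  by rewrite -[(u N - f) n]/(u N n - f n) opprB addrC subrK.
apply: le_lt_trans (ler_normB _ _) _.
by rewrite [ltRHS](splitr e) ltrD.
Qed.

Lemma bd_not_unique :
  (\sum_(0 <= k <oo) ((b k * mu k)^-1 + mu k)%:E < +oo)%E ->
  exists E F : L2form R, [/\ corresponds_to_rates a b E,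
    corresponds_to_rates a b F & ~ form_eq E F].
Proof.
move=> sfin; have [_ D1] := bd_finite_bounds sfin.
exists (bd_max_form a b), (bd_restricted_form vanishing); split.
- exact: bd_max_corresponds.
- apply: bd_restricted_corresponds; last exact: bd_vanishing_dirichlet.
  by move=> f n fn; apply: cvg_near_cst; exists n.
move=> [domE _].
have : form_dom (bd_restricted_form vanishing) (fun=> 1) by rewrite -domE.
move=> [_]; rewrite /vanishing /= => c0.
have c1 : (fun _ : nat => 1 : R) @ \oo --> (1 : R) by exact: cvg_cst.
have e01 : (0 : R) = 1 by exact: cvg_unique c0 c1.
by have := oner_neq0 R; rewrite -e01 eqxx.
Qed.

(** * Uniqueness: forms corresponding to the rates *)

Lemma sum_unit (c : nat -> R) n :
  (fun i => \sum_(0 <= j < n) c j * unit j i) = trunc n c.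
Proof.
apply/funext => i; rewrite /trunc; elim: n => [|n IH]; first by rewrite big_nil.
rewrite big_nat_recr//= IH /unit_fun ltnS [in RHS]leq_eqVlt.
case: eqVneq => [->|_] /=; first by rewrite ltnn add0r mulr1.
by rewrite mulr0 addr0.
Qed.

Lemma trunc_id f n : (forall i, (n <= i)%N -> f i = 0) -> trunc n f = f.
Proof.
by move=> fn; apply/funext => i; rewrite /trunc; case: ltnP => // /fn.
Qed.

Lemma trunc_out f n i : (n <= i)%N -> trunc n f i = 0.
Proof. by rewrite /trunc ltnNge => ->. Qed.

Lemma trunc_L2 f n : L2 mu (trunc n f).
Proof. by apply: (L2_fin bd_mu_gt0 (n := n)) => i; exact: trunc_out. Qed.

Lemma linear_trunc (P : (nat -> R) -> nat -> R) (c : nat -> R) n i :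
  (forall s f g, L2 mu f -> L2 mu g -> P (s *: f + g) = s *: P f + P g) ->
  P (trunc n c) i = \sum_(0 <= j < n) c j * P (unit j) i.
Proof.
move=> Plin; elim: n => [|n IH].
  have L0 : L2 mu 0 by exact: (L2_0 bd_mu_gt0).
  have t0 : trunc 0 c = 0 by apply/funext => j.
  have := Plin (-1) _ _ L0 L0; rewrite scaler0 addr0 scaleN1r addNr => P0.
  by rewrite big_nil t0 P0.
have -> : trunc n.+1 c = c n *: unit n + trunc n c.
  apply/funext => j; rewrite -[RHS]/(c n * unit n j + trunc n c j).
  have e m : trunc m c j = \sum_(0 <= k < m) c k * unit k j by rewrite -sum_unit.
  by rewrite !e big_nat_recr//= addrC.
rewrite Plin; [|exact: unit_L2|exact: trunc_L2].
by rewrite -[LHS]/(c n * P (unit n) i + P (trunc n c) i) IH big_nat_recr//= addrC.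
Qed.

(** For finitely supported [f], [<f - T_t f, f> / t] is a finite combination of difference quotients
    of the [p_ij], so the rates determine its limit; membership and value then come from the
    recovery of [E] from its semigroup. *)
Lemma corresponds_fin_val E f n : corresponds_to_rates a b E ->
  (forall i, (n <= i)%N -> f i = 0) ->
  form_dom E f /\ E f f = - \sum_(0 <= i < n) mu i * f i *
    (\sum_(0 <= j < n) f j * bd_Q a b i j).
Proof.
move=> [dE [T ET rates]] fn.
have cf := dirichlet_closed_form bd_mu_gt0 dE.
have [SE sS genS] := semigroup_of_sym bd_mu_gt0 dE ET.
have [sT _] := ET; pose S t (g : l2 bd_mu_gt0) := l2_lift bd_mu_gt0 (T t g).
have Lf : L2 mu f by exact: (L2_fin bd_mu_gt0 fn).
have [f' f'E] := l2_exists bd_mu_gt0 Lf.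
set C := - _.
suff H : (fun t => t^-1 * l2dot (f' - S t f') f') @ 0^'+ --> C.
  have Df := sg_form_dom (l2_ip bd_mu_gt0) cf sS genS H.
  have := sg_form_val (l2_ip bd_mu_gt0) cf sS genS H.
  by rewrite /l2_form f'E => ->; split=> //; rewrite -f'E.
have h : (fun t => - \sum_(0 <= i < n) mu i * f i * (\sum_(0 <= j < n) f j *
    (t^-1 * (transition_fun T t i j - transition_fun T 0 i j)))) @ 0^'+ --> C.
  apply: cvgN; apply: cvg_sum_nat => i; apply: cvgMl_tmp.
  by apply: cvg_sum_nat => j; apply: cvgMl_tmp; exact: rates.
apply: cvg_trans h; apply: near_eq_cvg; near=> t.
have t0 : 0 < t by [].
have S't : l2val (S t f') = T t f.
  by rewrite -(SE t f (ltW t0) Lf); congr (l2val (S t _)); apply: val_inj; rewrite /= l2_liftE.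
rewrite /l2dot l2val_sub S't f'E L2dot_sym (L2dot_fin _ _ fn) mulr_sumr -sumrN.
apply: eq_bigr => i _; rewrite -mulrN mulrCA; congr (_ * _).
have -> : (f - T t f) i = f i - T t f i by [].
have Tlin s g h : L2 mu g -> L2 mu h -> T t (s *: g + h) = s *: T t g + T t h.
  by apply: (sg_lin sT); exact: ltW.
rewrite -{3}(trunc_id fn) (linear_trunc _ _ _ Tlin).
have -> : f i = \sum_(0 <= j < n) f j * unit j i.
  by have := sum_unit f n => /(congr1 (@^~ i)) /=; rewrite (trunc_id fn) => ->.
rewrite -sumrB mulr_sumr -sumrN; apply: eq_bigr => j _.
by rewrite /transition_fun (sg_0 sT (unit_L2 j)); ring.
Unshelve. all: by end_near. Qed.

(** The value just found depends on the rates alone, and the maximal form also corresponds to them;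
    this spares computing the sum. *)
Lemma corresponds_fin_sq E f : corresponds_to_rates a b E -> fin_support f ->
  form_dom E f /\ E f f = bd_form f f.
Proof.
move=> cE /fin_supportP[n fn].
have [Df ->] := corresponds_fin_val cE fn; split => //.
by have [_] := corresponds_fin_val bd_max_corresponds fn.
Qed.

Lemma polarization (D : set (nat -> R)) (B B' : (nat -> R) -> (nat -> R) -> R) :
  semi_inner D B -> semi_inner D B' -> (forall f, D f -> B f f = B' f f) ->
  forall f g, D f -> D g -> B f g = B' f g.
Proof.
move=> hB hB' BB' f g Df Dg.
have := si_sqDZ hB 1 Df Dg; have := si_sqDZ hB' 1 Df Dg; rewrite scale1r.
rewrite !BB'//; last exact: (si_D hB).
by move=> -> H; lra.
Qed.

Lemma corresponds_fin E f g : corresponds_to_rates a b E ->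
  fin_support f -> fin_support g -> E f g = bd_form f g.
Proof.
move=> cE; have dE : dirichlet_form mu E by case: cE.
have K0 : @fin_support R 0 by apply/fin_supportP; exists 0%N.
apply: (polarization (D := @fin_support R)) => [||h Kh].
- apply: (semi_inner_sub (dirichlet_si dE)) => //; last exact: fin_support_lin.
  by move=> h Kh; have [] := corresponds_fin_sq cE Kh.
- apply: (semi_inner_sub bd_form_si) => //; last exact: fin_support_lin.
  exact: fin_support_max.
by have [] := corresponds_fin_sq cE Kh.
Qed.

(** [u = J_h f] minimizes [|u - f|^2 + h E u u]. Clipping [u] to [[0, 1]] increases neither term,
    since [f] is unchanged by clipping, so [u] equals its clipped version [v]. *)
Lemma resolvent_markov E h (f : l2 bd_mu_gt0) (dE : dirichlet_form mu E) :
  0 < h -> (forall i, 0 <= f i <= 1) ->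
  forall i, 0 <= (resolvent (@l2dot _ _ bd_mu_gt0) (l2_dom E) (l2_form E) h f) i <= 1.
Proof.
move=> h0 f01; have cf := dirichlet_closed_form bd_mu_gt0 dE.
have ip := l2_ip bd_mu_gt0.
pose f0 : nat -> R := l2val f.
set u : nat -> R := l2val (resolvent _ _ _ h f).
have Du : form_dom E u by exact: (resolvent_dom ip cf f h0).
pose v : nat -> R := fun i => Num.min (Num.max (u i) 0) 1.
have [Dv Ev] : form_dom E v /\ E v v <= E u u := df_markov dE Du.
have Lu : L2 mu u by exact: l2_L2.
have Lv : L2 mu v := df_L2 dE Dv; have Lf : L2 mu f0 by exact: l2_L2.
have hE := dirichlet_si dE; have hL := L2_si bd_mu_gt0.
have Luf := si_B hL Lu Lf; have Lvf := si_B hL Lv Lf; have Lvu := si_B hL Lv Lu.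
have Dvu := si_B hE Dv Du.
have uP : L2dot mu u (v - u) + h * E u (v - u) = L2dot mu f0 (v - u).
  have [g gE] := l2_exists bd_mu_gt0 Lvu.
  have Dg : l2_dom E g by rewrite /l2_dom /= gE.
  by have := resolventE ip cf f h0 Dg; rewrite /l2dot /l2_form gE.
have vf : L2dot mu (v - f0) (v - f0) <= L2dot mu (u - f0) (u - f0).
  apply: (L2dot_le bd_mu_gt0) => n; apply: le_trans (L2dot_ge bd_mu_gt0 n Luf).
  apply: ler_sum => i _; rewrite ler_wpM2l ?(ltW (bd_mu_gt0 i))//.
  have -> : (v - f0) i = v i - Num.min (Num.max (f0 i) 0) 1.
    by have /andP[p q] := f01 i; rewrite max_l// min_l.
  exact/ler_norm_sqr/clip_dist.
(* Expanding the two comparisons around [u], the cross terms cancel by the equation [uP] of the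
   minimizer. *)
have key : L2dot mu (v - u) (v - u) + h * E (v - u) (v - u) <= 0.
  have e1 : L2dot mu (v - f0) (v - f0) = L2dot mu (v - u) (v - u)
      + 2 * L2dot mu (u - f0) (v - u) + L2dot mu (u - f0) (u - f0).
    rewrite -[v - f0](subrKA u); have := si_sqDZ hL 1 Lvu Luf.
    by rewrite scale1r => ->; rewrite (L2dot_sym mu (v - u) (u - f0)); ring.
  have e2 : E v v = E (v - u) (v - u) + 2 * E u (v - u) + E u u.
    rewrite -[in LHS](subrK u v); have := si_sqDZ hE 1 Dvu Du.
    by rewrite scale1r => ->; rewrite (si_sym hE Dvu Du); ring.
  have e3 : L2dot mu (u - f0) (v - u) = - (h * E u (v - u)).
    by rewrite (siBl hL Lu Lf Lvu) -uP; ring.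
  have := ler_wpM2l (ltW h0) Ev; rewrite e2.
  move: vf; rewrite e1 e3; lra.
have vu i : u i = v i.
  have := L2dot_ge_term bd_mu_gt0 i Lvu.
  have := mulr_ge0 (ltW h0) (si_ge0 hE Dvu) => h1 h2.
  have : mu i * (v - u) i ^+ 2 <= 0 by lra.
  rewrite pmulr_rle0 ?bd_mu_gt0// => h3.
  have : (v - u) i == 0 by rewrite -sqrf_eq0 eq_le h3 sqr_ge0.
  by rewrite subr_eq0 => /eqP.
move=> i; rewrite vu /v.
by rewrite le_min ler01 le_max lexx orbT /= ge_min lexx orbT.
Qed.

(** Only the entries [(i, i+1)] and [(i+1, i)] are retained: these are the edges of the birth-death
    graph. *)
Lemma nn_sum_ge (x : nat -> nat -> R) m : (forall i j, 0 <= x i j) ->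
  (forall i j, x i j = x j i) ->
  2 * \sum_(0 <= i < m) x i i.+1 <=
  \sum_(0 <= i < m.+1) \sum_(0 <= j < m.+1) x i j.
Proof.
move=> x0 xC; elim: m => [|m IH].
  by rewrite big_nil mulr0; apply: sumr_ge0 => i _; exact: sumr_ge0.
rewrite [X in 2 * X]big_nat_recr//= mulrDr.
rewrite [leRHS]big_nat_recr//=.
under [X in _ <= X + _]eq_bigr do rewrite big_nat_recr//=.
rewrite big_split /= [X in _ + X + _]big_nat_recr//= [X in _ + _ + X]big_nat_recr//=.
rewrite [\sum_(0 <= i < m.+1) x m.+1 i]big_nat_recr//=.
have s1 : 0 <= \sum_(0 <= i < m) x i m.+1 by exact: sumr_ge0.
have s2 : 0 <= \sum_(0 <= i < m) x m.+1 i by exact: sumr_ge0.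
have := x0 m.+1 m.+1; rewrite (xC m.+1 m); lra.
Qed.

(* Beurling--Deny: with [K i j = mu_i P_ij] symmetric,
   [<f - P f, f> = 1/2 sum K_ij (f_i - f_j)^2 + sum f_i^2 (mu_i - sum_j K_ij)]. *)
Lemma markov_energy (P : (nat -> R) -> nat -> R) f m :
  (forall s f g, L2 mu f -> L2 mu g -> P (s *: f + g) = s *: P f + P g) ->
  (forall f g, L2 mu f -> L2 mu g -> L2dot mu (P f) g = L2dot mu f (P g)) ->
  (forall f, L2 mu f -> (forall i, 0 <= f i <= 1) -> forall i, 0 <= P f i <= 1) ->
  (forall i, (m.+1 <= i)%N -> f i = 0) ->
  \sum_(0 <= i < m) mu i * P (unit i.+1) i * d f i ^+ 2 <= L2dot mu (f - P f) f.
Proof.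
move=> Plin Psym Pmk fm.
pose K i j := mu i * P (unit j) i.
have KC i j : K i j = K j i.
  have := Psym _ _ (unit_L2 j) (unit_L2 i).
  by rewrite L2dot_unit L2dot_sym L2dot_unit.
have K0 i j : 0 <= K i j.
  apply: mulr_ge0; first exact: ltW (bd_mu_gt0 i).
  have /(_ _ i)/andP[] // := Pmk _ (unit_L2 j).
  by move=> k; rewrite /unit_fun; case: eqP; rewrite /= ?lexx ?ler01.
(* [P] is applied to the indicator of [{0, ..., m}], whose image is at most 1. *)
have K1 i : \sum_(0 <= j < m.+1) K i j <= mu i.
  have := Pmk _ (trunc_L2 (fun=> 1) m.+1) _ i.
  rewrite (linear_trunc _ _ _ Plin) => /(_ _)/andP[].
    by move=> k; rewrite /trunc; case: ifP; rewrite ?lexx ?ler01.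
  move=> _ H; rewrite /K -mulr_sumr -[leRHS]mulr1 ler_wpM2l//.
    exact: ltW (bd_mu_gt0 i).
  by apply: le_trans H; apply: ler_sum => j _; rewrite mul1r.
have -> : L2dot mu (f - P f) f = \sum_(0 <= i < m.+1) mu i * f i ^+ 2 -
    \sum_(0 <= i < m.+1) \sum_(0 <= j < m.+1) K i j * f i * f j.
  rewrite L2dot_sym (L2dot_fin _ _ fm) -sumrB; apply: eq_bigr => i _.
  have -> : (f - P f) i = f i - P f i by [].
  rewrite -{3}(trunc_id fm) (linear_trunc _ _ _ Plin) mulrBr.
  congr (_ - _); first by ring.
  by rewrite mulr_sumr; apply: eq_bigr => j _; rewrite /K; ring.
have H := @nn_sum_ge (fun i j => K i j * (f i - f j) ^+ 2) m _ _.
have {H} H : 2 * \sum_(0 <= i < m) K i i.+1 * (f i - f i.+1) ^+ 2 <=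
    \sum_(0 <= i < m.+1) \sum_(0 <= j < m.+1) K i j * (f i - f j) ^+ 2.
  by apply: H => i j; [rewrite mulr_ge0 ?sqr_ge0|rewrite KC; ring].
have e1 : \sum_(0 <= i < m) mu i * P (unit i.+1) i * d f i ^+ 2 =
    \sum_(0 <= i < m) K i i.+1 * (f i - f i.+1) ^+ 2.
  by apply: eq_bigr => i _; rewrite /K; ring.
have e2 : \sum_(0 <= i < m.+1) \sum_(0 <= j < m.+1) K i j * (f i - f j) ^+ 2 =
    2 * \sum_(0 <= i < m.+1) \sum_(0 <= j < m.+1) K i j * f i ^+ 2 -
    2 * \sum_(0 <= i < m.+1) \sum_(0 <= j < m.+1) K i j * f i * f j.
  have e3 : \sum_(0 <= i < m.+1) \sum_(0 <= j < m.+1) K i j * f j ^+ 2 =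
      \sum_(0 <= i < m.+1) \sum_(0 <= j < m.+1) K i j * f i ^+ 2.
    rewrite exchange_big /=; apply: eq_bigr => i _; apply: eq_bigr => j _.
    by rewrite KC.
  have -> : \sum_(0 <= i < m.+1) \sum_(0 <= j < m.+1) K i j * (f i - f j) ^+ 2 =
    \sum_(0 <= i < m.+1) \sum_(0 <= j < m.+1) K i j * f i ^+ 2 +
    \sum_(0 <= i < m.+1) \sum_(0 <= j < m.+1) K i j * f j ^+ 2 -
    2 * \sum_(0 <= i < m.+1) \sum_(0 <= j < m.+1) K i j * f i * f j.
    rewrite -big_split /= mulr_sumr -sumrB; apply: eq_bigr => i _.
    rewrite -big_split /= mulr_sumr -sumrB; apply: eq_bigr => j _; ring.
  by rewrite e3; ring.
have e4 : \sum_(0 <= i < m.+1) \sum_(0 <= j < m.+1) K i j * f i ^+ 2 <=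
    \sum_(0 <= i < m.+1) mu i * f i ^+ 2.
  apply: ler_sum => i _; rewrite -mulr_suml ler_wpM2r ?sqr_ge0//.
rewrite e1; lra.
Qed.

(** The bound [E f f] is shown for each partial sum over [m] edges. With [m] fixed, truncations of
    [f] are removed first, at fixed [h]; then [h] tends to 0. *)
Lemma corresponds_dom_max E f : corresponds_to_rates a b E -> form_dom E f ->
  bd_max_dom f.
Proof.
move=> cE Df; have dE : dirichlet_form mu E by case: cE.
have cf := dirichlet_closed_form bd_mu_gt0 dE.
have ip := l2_ip bd_mu_gt0.
have Lf := df_L2 dE Df; have [f' f'E] := l2_exists bd_mu_gt0 Lf.
have Df' : l2_dom E f' by rewrite /l2_dom /= f'E.
split=> //; apply: (bound_L2 bd_w_gt0 (M := E f f)) => m.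
pose J h := resolvent (@l2dot _ _ bd_mu_gt0) (l2_dom E) (l2_form E) h.
pose P h (g : nat -> R) := l2val (J h (l2_lift bd_mu_gt0 g)).
have cJ h : contraction (J h) := resolvent_ct ip cf h.
have Plin h s g k : L2 mu g -> L2 mu k -> P h (s *: g + k) = s *: P h g + P h k.
  move=> Lg Lk; rewrite /P -l2val_lin -(ct_lin (cJ h)); congr (l2val (J h _)).
  by apply: val_inj; rewrite /= l2_liftE ?l2val_lin ?l2_liftE//; exact: (L2_lin bd_mu_gt0).
have Psym h g k : L2 mu g -> L2 mu k -> L2dot mu (P h g) k = L2dot mu g (P h k).
  move=> Lg Lk; have := resolvent_sym ip cf h (l2_lift bd_mu_gt0 g) (l2_lift bd_mu_gt0 k).
  by rewrite /l2dot !l2_liftE.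
have Pmk h : 0 < h -> forall g, L2 mu g -> (forall i, 0 <= g i <= 1) ->
    forall i, 0 <= P h g i <= 1.
  move=> h0 g Lg g01; apply: resolvent_markov => // i; by rewrite l2_liftE.
have en h : 0 < h ->
    \sum_(0 <= i < m) mu i * P h (unit i.+1) i * d f i ^+ 2 <= L2dot mu (f - P h f) f.
  move=> h0.
  have tf : (fun n => l2_lift bd_mu_gt0 (trunc n f)) @ \oo --> f'.
    apply/cvgrPdist_lt => e e0.
    have [N HN] := trunc_small bd_mu_gt0 Lf (exprn_gt0 2 e0).
    exists N => // n /HN.
    by rewrite l2_normE l2val_sub f'E l2_liftE ?L2norm_lt//; exact: trunc_L2.
  have : (fun n => l2dot (l2_lift bd_mu_gt0 (trunc n f) - J h (l2_lift bd_mu_gt0 (trunc n f)))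
      (l2_lift bd_mu_gt0 (trunc n f))) @ \oo --> l2dot (f' - J h f') f'.
    by apply: (dot_cvg ip) => //; apply: cvgB => //; exact: ct_cvg (cJ h) tf.
  have <- : l2dot (f' - J h f') f' = L2dot mu (f - P h f) f.
    rewrite /l2dot l2val_sub f'E; congr (L2dot mu (f - l2val (J h _)) f).
    by apply: val_inj; rewrite /= l2_liftE.
  (* Truncation beyond [m] leaves the first [m] increments intact, and the other edges contribute
     nonnegative terms. *)
  move=> /cvgr_to_ge; apply; exists m.+1 => // -[//|n] /= mn.
  have mn' : (m <= n)%N by [].
  have := markov_energy (Plin h) (Psym h) (Pmk h h0) (trunc_out f (n := n.+1)).
  rewrite /l2dot l2val_sub l2_liftE; last exact: trunc_L2.
  apply: le_trans; rewrite (big_cat_nat (leq0n m) mn')//=.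
  have -> : \sum_(0 <= i < m) mu i * P h (unit i.+1) i * d f i ^+ 2 =
      \sum_(0 <= i < m) mu i * P h (unit i.+1) i * d (trunc n.+1 f) i ^+ 2.
    apply: eq_big_nat => i /andP[_ im]; rewrite /trunc !ltnS.
    by rewrite (leq_trans im mn') (leq_trans (ltnW im) mn').
  rewrite lerDl; apply: sumr_ge0 => i _.
  rewrite mulr_ge0 ?sqr_ge0// mulr_ge0 ?(ltW (bd_mu_gt0 i))//.
  have /(_ _ i)/andP[] // := Pmk h h0 _ (unit_L2 i.+1).
  by move=> k; rewrite /unit_fun; case: eqP; rewrite /= ?lexx ?ler01.
(* The supports of [unit i.+1] and [unit i] are disjoint, so the coefficient is minus the
   approximating form at this pair; its limit [- E (unit i.+1) (unit i)] is [mu i b i], as [E]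
   agrees with [bd_form] on finite supports. *)
have lim : (fun h => \sum_(0 <= i < m) (h^-1 * (mu i * P h (unit i.+1) i)) * d f i ^+ 2)
    @ 0^'+ --> \sum_(0 <= i < m) w i * d f i ^+ 2.
  apply: cvg_sum_nat => i; apply: cvgMr_tmp.
  have Ku j : fin_support (unit j).
    by apply/fin_supportP; exists j.+1 => k; exact: unit_out.
  have Du j : l2_dom E (l2_lift bd_mu_gt0 (unit j)).
    rewrite /l2_dom /= l2_liftE; last exact: unit_L2.
    by have [] := corresponds_fin_sq cE (Ku j).
  have := resolvent_form_cvg ip cf (Du i.+1) (Du i).
  rewrite /l2_form !l2_liftE; [|exact: unit_L2|exact: unit_L2].
  rewrite (corresponds_fin cE (Ku _) (Ku _)) bd_form_unitQ L2dot_unit bd_QU => H.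
  rewrite -[mu i * b i]opprK.
  have -> : (fun h => h^-1 * (mu i * P h (unit i.+1) i)) =
      (fun h => - (h^-1 * l2dot (l2_lift bd_mu_gt0 (unit i.+1) -
        J h (l2_lift bd_mu_gt0 (unit i.+1))) (l2_lift bd_mu_gt0 (unit i)))).
    apply/funext => h; rewrite -mulrN; congr (_ * _).
    rewrite /l2dot l2val_sub !l2_liftE; [|exact: unit_L2|exact: unit_L2].
    rewrite L2dot_unit -mulrN; congr (_ * _).
    rewrite -[X in - X]/(unit i.+1 i - P h (unit i.+1) i).
    by rewrite /unit_fun ltn_eqF// sub0r opprK.
  exact: cvgN.
move: lim => /cvgr_to_le; apply; near=> h.
have h0 : 0 < h by [].
have := resolvent_form_dot_le ip cf h0 Df'.
rewrite /l2_form f'E; apply: le_trans.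
have -> : \sum_(0 <= i < m) h^-1 * (mu i * P h (unit i.+1) i) * d f i ^+ 2 =
  h^-1 * \sum_(0 <= i < m) mu i * P h (unit i.+1) i * d f i ^+ 2.
  by rewrite mulr_sumr; apply: eq_bigr => i _; rewrite !mulrA.
rewrite ler_wpM2l ?invr_ge0 ?(ltW h0)//; apply: le_trans (en h h0) _.
rewrite /l2dot l2val_sub f'E /P.
have -> // : l2_lift bd_mu_gt0 f = f' by apply: val_inj; rewrite /= l2_liftE.
Unshelve. all: by end_near. Qed.

(** Finitely supported [g n] approximating [f] in the maximal norm are also Cauchy for [E], because
    the two forms agree on their differences. Closedness of [E] yields a limit, and convergence of
    coordinates identifies it with [f]. *)
Lemma corresponds_max_dom E f :
  (\sum_(0 <= k <oo) ((b k * mu k)^-1 + mu k)%:E = +oo)%E ->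
  corresponds_to_rates a b E -> bd_max_dom f ->
  form_dom E f /\ E f f = bd_form f f.
Proof.
move=> soo cE Df; have dE : dirichlet_form mu E by case: cE.
have hE := dirichlet_si dE; have hD := bd_form_si; have hL := L2_si bd_mu_gt0.
have H n : exists g, fin_support g /\
    L2dot mu (f - g) (f - g) + bd_form (f - g) (f - g) < n.+1%:R^-1.
  have n0 : 0 < n.+1%:R^-1 :> R by rewrite invr_gt0.
  by have [g Kg Hg] := bd_fin_support_dense soo Df n0; exists g.
have [g gP] := choice H.
have Kg n : fin_support (g n) by case: (gP n).
have Dg n := fin_support_max (Kg n).
have DgE n : form_dom E (g n) by have [] := corresponds_fin_sq cE (Kg n).
have Kmn m n : fin_support (g m - g n).
  by rewrite addrC -scaleN1r; exact: fin_support_lin.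
have LE h : form_dom E h -> L2 mu h by move=> Dh; exact: (df_L2 dE Dh).
have Lf : L2 mu f by case: Df.
have Lg n := LE _ (DgE n).
have B0 h : bd_max_dom h -> 0 <= L2dot mu h h /\ 0 <= bd_form h h.
  by move=> Dh; split; [apply: (si_ge0 hL); case: Dh|exact: (si_ge0 hD)].
have gf : (fun n => L2dot mu (g n - f) (g n - f)) @ \oo --> (0 : R) /\
    (fun n => bd_form (g n - f) (g n - f)) @ \oo --> (0 : R).
  have small n : L2dot mu (g n - f) (g n - f) + bd_form (g n - f) (g n - f) < n.+1%:R^-1.
    by have [_] := gP n; rewrite (si_sqC hL Lf (Lg n)) (si_sqC hD Df (Dg n)).
  have nn n := B0 _ (si_B hD (Dg n) Df).
  split; apply/cvgr0Pnorm_lt => e e0; have [N HN] := harmonic_small e0;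
    exists N => // n /= /HN; apply: lt_trans; have [x0 y0] := nn n;
    by rewrite ger0_norm//; apply: le_lt_trans (small n); rewrite ?lerDl ?lerDr.
have [uL uD] := gf.
have [e e0|f1 Df1 uf] := dirichlet_complete bd_mu_gt0 dE DgE.
  have e40 : 0 < e / 4 by rewrite divr_gt0.
  have [N HN] := harmonic_small e40; exists N => m n Nm Nn.
  rewrite (corresponds_fin cE (Kmn m n) (Kmn m n)).
  have [_ g1] := gP m; have [_ g2] := gP n.
  have := si_sqB_le hL (Lg m) Lf (Lg n); have := si_sqB_le hD (Dg m) Df (Dg n).
  rewrite (si_sqC hL (Lg m) Lf) (si_sqC hD (Dg m) Df).
  move=> h1 h2; have h3 := lt_trans g1 (HN _ Nm); have h4 := lt_trans g2 (HN _ Nn).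
  lra.
have Dgf n : form_dom E (g n - f1) by exact: (si_B hE).
have [uL1 uE] : (fun n => L2dot mu (g n - f1) (g n - f1)) @ \oo --> (0 : R) /\
    (fun n => E (g n - f1) (g n - f1)) @ \oo --> (0 : R).
  split; apply/cvgr0Pnorm_lt => e e0; move/cvgr0Pnorm_lt : uf => /(_ _ e0);
    apply: filterS => n; have x0 := si_ge0 hL (LE _ (Dgf n));
    have y0 := si_ge0 hE (Dgf n); rewrite !ger0_norm ?addr_ge0//; lra.
have ff1 : f = f1.
  apply/funext => i.
  have c1 := L2dot_pointwise bd_mu_gt0 (i := i) (fun n => si_B hL (Lg n) Lf) uL.
  have c2 := L2dot_pointwise bd_mu_gt0 (i := i) (fun n => LE _ (Dgf n)) uL1.
  exact: cvg_unique c1 c2.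
subst f1; split=> //.
have c1 := si_cvg_sq hD Dg Df uD; have c2 := si_cvg_sq hE DgE Df1 uE.
apply: cvg_unique c2 _ => //; apply: cvg_trans c1; apply: near_eq_cvg.
by apply: nearW => n; rewrite (corresponds_fin cE (Kg n) (Kg n)).
Qed.

Lemma corresponds_eq_max E :
  (\sum_(0 <= k <oo) ((b k * mu k)^-1 + mu k)%:E = +oo)%E ->
  corresponds_to_rates a b E -> form_eq E (bd_max_form a b).
Proof.
move=> soo cE; have dE : dirichlet_form mu E by case: cE.
have domE : form_dom E = bd_max_dom.
  apply/seteqP; split=> f; first exact: corresponds_dom_max.
  by move=> Df; have [] := corresponds_max_dom soo cE Df.
split=> [|f g Df Dg]; first exact: domE.
apply: (polarization (D := form_dom E) (B' := bd_form)) Df Dg.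
- exact: (dirichlet_si dE).
- by rewrite domE; exact: bd_form_si.
by rewrite domE => h Dh; have [] := corresponds_max_dom soo cE Dh.
Qed.

End birth_death.

Theorem proposition1p3 (R : realType) (a b : nat -> R)
  (hb : forall i, 0 < b i)
  (ha : forall i, (1 <= i)%N -> 0 < a i)
  (ha0 : a 0%N = 0) :
  [/\ dirichlet_form (bd_mu a b) (bd_max_form a b),
      regular_form (bd_mu a b) (bd_max_form a b) <->
        (\sum_(0 <= k <oo) ((b k * bd_mu a b k)^-1 + bd_mu a b k)%:E = +oo)%E,
      (exists E : L2form R, corresponds_to_rates a b E) &
      (forall E F : L2form R, corresponds_to_rates a b E ->
         corresponds_to_rates a b F -> form_eq E F) <->
        (\sum_(0 <= k <oo) ((b k * bd_mu a b k)^-1 + bd_mu a b k)%:E = +oo)%E].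
Proof.
have fin_or_oo : (\sum_(0 <= k <oo) ((b k * bd_mu a b k)^-1 + bd_mu a b k)%:E < +oo)%E \/
    (\sum_(0 <= k <oo) ((b k * bd_mu a b k)^-1 + bd_mu a b k)%:E = +oo)%E.
  by case: ltP => [|oo]; [left|right; apply/eqP; rewrite eq_le leey].
split.
- exact: bd_max_dirichlet.
- split=> [reg|]; last exact: bd_regular_of_infinite.
  by case: fin_or_oo => // /(bd_not_regular hb ha)/(_ reg).
- by exists (bd_max_form a b); exact: bd_max_corresponds.
- split=> [uniq|soo E F cE cF].
    case: fin_or_oo => // /(bd_not_unique hb ha ha0)[E [F [cE cF]]].
    by case; exact: uniq.
  have [dE vE] := corresponds_eq_max hb ha ha0 soo cE.
  have [dF vF] := corresponds_eq_max hb ha ha0 soo cF.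
  split=> [|f g Df Dg]; first by rewrite dE dF.
  by rewrite vE// vF// dF -dE.
Qed.
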